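(* Let $U\subset\mathbb{R}^2$ be an open set containing the points $(\frac12,\frac12)$ and $(-\frac12,\frac12)$. If $(x,y)$ is the normalized location of a north-going domino space in the Aztec diamond of order $n$, and $(x,y)\notin U$, then, as $n\to\infty$, the placement probability at $(x,y)$ is within $o(1)$ of $\mathcal{P}(x,y)$, where $$\mathcal{P}(x,y)=\begin{cases}0&\text{if }x^2+y^2\ge\frac12\text{ and }y<\frac12,\\ 1&\text{if }x^2+y^2\ge\frac12\text{ and }y>\frac12,\\ \frac12+\frac1\pi\tan^{-1}\left(\frac{2y-1}{\sqrt{1-2x^2-2y^2}}\right)&\text{if }x^2+y^2<\frac12.\end{cases}$$ The $o(1)$ error bound is uniform in $(x,y)$ for $(x,y)\notin U$; that is, for every $\eta>0$ there is $N$ such that for all $n\ge N$ and every north-going domino space of the Aztec diamond of order $n$ whose normalized location $(x,y)$ is not in $U$, the placement probability of that domino space differs from $\mathcal{P}(x,y)$ by less than $\eta$.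
   Context: The Aztec diamond of order $n$ is the union of those unit lattice squares (squares with corners in $\mathbb{Z}^2$) whose interiors lie inside $\{(x,y):|x|+|y|\le n+1\}$. A domino is a $1\times2$ or $2\times 1$ rectangle made of two adjacent lattice squares; random domino tilings of the diamond are chosen from the uniform distribution on all its domino tilings. Color the lattice squares of the diamond in checkerboard fashion so that the leftmost square in each row in the top half of the diamond is white. A domino space is the union of two adjacent squares of the diamond (a place where a domino could be); a horizontal domino space is north-going if its leftmost square is white. The location of a north-going domino space is the midpoint $(\ell,m)$ of its bottom edge (so $|\ell|+|m|\le n-1$), and its normalized location is $(x,y)=(\ell/n,m/n)$ (so $|x|+|y|<1$). The placement probability of a domino space is the probability that a uniformly random domino tiling of the diamond contains a domino occupying exactly that domino space. *)

(* Defs.v *)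
From HB Require Import structures.
From mathcomp Require Import all_boot all_order all_algebra finmap zify lra.
From mathcomp Require Import all_classical all_reals all_analysis.
Set Implicit Arguments.
Unset Strict Implicit.
Unset Printing Implicit Defensive.
Import Order.TTheory GRing.Theory Num.Theory.
Import numFieldNormedType.Exports.
Local Open Scope classical_set_scope.
Local Open Scope ring_scope.

(* A lattice square is named by its lower left corner. *)
Definition square := (int * int)%type.

Definition unit_square (R : realType) (s : square) : set (R * R) :=
  [set p | s.1%:~R <= p.1 <= (s.1 + 1)%:~R /\
           s.2%:~R <= p.2 <= (s.2 + 1)%:~R].

Definition aztec (R : realType) (n : nat) : set square :=
  [set s | (@unit_square R s)° `<=` [set p | `|p.1| + `|p.2| <= n.+1%:R]].

Definition right_of (s : square) : square := (s.1 + 1, s.2).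
Definition above (s : square) : square := (s.1, s.2 + 1).

(* A domino space is the set of the two squares that it covers. *)
Definition hspace (s : square) : {fset square} := [fset s; right_of s]%fset.
Definition vspace (s : square) : {fset square} := [fset s; above s]%fset.

Definition domino_space (R : realType) (n : nat) (d : {fset square}) : Prop :=
  (exists s, d = hspace s \/ d = vspace s) /\
  (forall s, s \in d -> aztec R n s).

Definition tilings (R : realType) (n : nat) : set {fset {fset square}} :=
  [set t | (forall d, d \in t -> domino_space R n d) /\
           (forall s, aztec R n s -> exists! d, d \in t /\ s \in d)].

Definition placement_prob (R : realType) (n : nat) (d : {fset square}) : R :=
  #|` fset_set [set t | tilings R n t /\ d \in t]|%:R /
  #|` fset_set (tilings R n)|%:R.

Definition aztec_coloring (R : realType) (n : nat) (white : square -> bool) :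
    Prop :=
  [/\ forall s, aztec R n s -> aztec R n (right_of s) ->
        white (right_of s) = ~~ white s,
      forall s, aztec R n s -> aztec R n (above s) ->
        white (above s) = ~~ white s
    & forall s, aztec R n s -> 0 <= s.2 ->
        (forall s', aztec R n s' -> s'.2 = s.2 -> s.1 <= s'.1) -> white s].

(* The coloring exists and is unique on the diamond: see [north_goingE]. *)
Definition north_going (R : realType) (n : nat) (s : square) : Prop :=
  domino_space R n (hspace s) /\
  exists2 white, aztec_coloring R n white & white s.

(* The bottom edge of [hspace s] runs from [s] to [(s.1 + 2, s.2)]. *)
Definition location (s : square) : int * int := (s.1 + 1, s.2).

Definition normalized_location (R : realType) (n : nat) (s : square) : R * R :=
  ((location s).1%:~R / n%:R, (location s).2%:~R / n%:R).

(* When x^2 + y^2 >= 1/2 and y = 1/2 the intended function is undefined and the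
   value below is arbitrary; normalized locations satisfy |x| + |y| < 1, hence
   never fall in that case. *)
Definition limit_prob (R : realType) (p : R * R) : R :=
  let: (x, y) := p in
  if x ^+ 2 + y ^+ 2 < 1 / 2 then
    1 / 2 + 1 / pi * atan ((2 * y - 1) / Num.sqrt (1 - 2 * x ^+ 2 - 2 * y ^+ 2))
  else if y < 1 / 2 then 0 else 1.

Lemma aztecE (R : realType) (n : nat) (s : square) :
  aztec R n s <-> `|2 * s.1 + 1| + `|2 * s.2 + 1| <= 2 * n%:Z.
Proof.
case: s => i j /=; split => [h|h [x y] /interior_subset [/= hx hy]].
  pose c (k : int) : R := k%:~R + 1/2 + (if 0 <= k then 1/4 else - (1/4)).
  have hc k : (k%:~R : R) < c k < (k + 1)%:~R.
    by rewrite /c intrD; case: ifP => _; apply/andP; split; lra.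
  have /h /= : (@unit_square R (i, j))° (c i, c j).
    exists (`]i%:~R, (i + 1)%:~R[%classic, `]j%:~R, (j + 1)%:~R[%classic) => /=.
      by split; apply: open_nbhs_nbhs; split; [exact: interval_open | rewrite /= in_itv /= hc
        | exact: interval_open | rewrite /= in_itv /= hc].
    move=> [u v] /=; rewrite !in_itv /= => -[/andP[a b] /andP[a' b']].
    by split => /=; rewrite !ltW.
  have ac k : `|c k| = (`|2 * k + 1|)%:~R / 2 + 1/4 :> R.
    rewrite /c; case: ifPn => hk.
      rewrite !ger0_norm ?intrD ?intrM; [|lia|].
        by lra.
      have : (0 : R) <= k%:~R by rewrite ler0z.
      by lra.
    have hk1 : k + 1 <= 0 by lia.
    have hk2 : (k%:~R : R) + 1 <= 0 by rewrite -(intrD _ k 1) lerz0.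
    rewrite !ler0_norm ?intrN ?intrD ?intrM; [|lia|lra].
    by lra.
  rewrite !ac => hle.
  have : ((`|2 * i + 1| + `|2 * j + 1| + 1)%:~R : R) <= (2 * n%:Z + 2)%:~R.
    rewrite !intrD intrM -[n%:Z%:~R]/(n%:R).
    move: hle; rewrite -natr1; lra.
  by rewrite ler_int; lia.
have key (k : int) (z : R) : k%:~R <= z <= (k + 1)%:~R -> `|z| <= (`|2 * k + 1|)%:~R / 2 + 1/2.
  rewrite intrD intr_norm intrD intrM => /andP[a b].
  rewrite ler_norml; apply/andP; split.
    have := ler_norm (- (2 * k%:~R + 1 : R)); rewrite normrN; lra.
  have := ler_norm (2 * k%:~R + 1 : R); lra.
have h1 := key _ _ hx; have h2 := key _ _ hy.
have : ((`|2 * i + 1| + `|2 * j + 1|)%:~R : R) <= (2 * n%:Z)%:~R by rewrite ler_int.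
rewrite intrD intrM -[n%:Z%:~R]/(n%:R) -natr1; lra.
Qed.

Lemma finite_aztec (R : realType) n : finite_set (aztec R n).
Proof.
pose f (p : nat * nat) : square := (p.1%:Z - n%:Z, p.2%:Z - n%:Z).
apply: (@sub_finite_set _ _ (f @` (`I_(2 * n).+1 `*` `I_(2 * n).+1))).
  move=> [i j] /aztecE /= h.
  by exists (absz (i + n%:Z), absz (j + n%:Z)); rewrite /f /=; [split => /=; lia|congr (_, _); lia].
by apply: finite_image; apply: finite_setX; exact: finite_II.
Qed.

(* Hence [fset_set] does not degenerate in [placement_prob]. *)
Lemma finite_tilings (R : realType) n : finite_set (tilings R n).
Proof.
pose A := fset_set (aztec R n).
apply: (@sub_finite_set _ _ [set` fpowerset (fpowerset A)]); last exact: finite_fset.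
move=> t [ht _] /=; rewrite fpowersetE; apply/fsubsetP => d /ht [_ hd].
rewrite fpowersetE; apply/fsubsetP => s /hd sA.
by rewrite in_fset_set ?inE //; exact: finite_aztec.
Qed.

Definition parity_white (n : nat) (s : square) : bool := (2 %| s.1 + s.2 + n%:Z)%Z.

Lemma parity_coloring (R : realType) n : aztec_coloring R n (parity_white n).
Proof.
split; rewrite /parity_white /right_of /above.
- by move=> [i j] _ _ /=; lia.
- by move=> [i j] _ _ /=; lia.
move=> [i j] /aztecE /= h hj left.
have : aztec R n (j - n%:Z, j) by apply/aztecE => /=; lia.
move=> /left /=. lia.
Qed.

Lemma north_goingE (R : realType) n s : north_going R n s <->
  [/\ aztec R n s, aztec R n (right_of s) & parity_white n s].
Proof.
have mem d (P : square -> Prop) : (forall x, x \in hspace d -> P x) <-> P d /\ P (right_of d).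
  split=> [h|[h h'] x]; first by split; apply: h; rewrite !inE eqxx ?orbT.
  by rewrite !inE => /orP[] /eqP ->.
rewrite /north_going /domino_space mem; split.
  move=> [[_ [h1 h2]] [white col ws]]; split => //.
  case: col => cr ca cl.
  pose agree x := white x = parity_white n x.
  have top (i j : int) : 0 <= j -> aztec R n (i, j) -> agree (i, j).
    move=> hj hij.
    have [m hm] : exists m : nat, i = j - n%:Z + m%:Z.
      by exists (absz (i - j + n%:Z)); move/aztecE: hij => /=; lia.
    elim: m i hm hij => [|m IH] i hm hij.
      rewrite /agree /parity_white /=.
      have -> : white (i, j).
        apply: cl => //= -[i' j'] /aztecE /= h' e; lia.
      by symmetry; rewrite hm; lia.
    have hprev : aztec R n (i - 1, j) by move/aztecE: hij => /= ?; apply/aztecE => /=; lia.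
    have := cr _ hprev; rewrite /right_of /= subrK => /(_ hij).
    rewrite /agree => ->; rewrite (IH (i - 1)) //; last lia.
    by rewrite /parity_white /=; lia.
  have all (i j : int) : aztec R n (i, j) -> agree (i, j).
    move=> hij; case: (leP 0 j) => hj; first exact: top.
    have [m hm] : exists m : nat, j = - m%:Z by exists (absz j); lia.
    elim: m j hm hij {hj} => [|m IH] j hm hij; first by apply: top => //; rewrite hm.
    have hup : aztec R n (i, j + 1) by move/aztecE: hij => /= ?; apply/aztecE => /=; lia.
    have := ca _ hij; rewrite /above /= => /(_ hup).
    rewrite (IH (j + 1)) //; last lia.
    by rewrite /agree /parity_white /=; case: (white _); lia.
  by case: s h1 h2 ws => i j h1 h2; rewrite all.
move=> [h1 h2 h3]; split; first by split => //; exists s; left.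
by exists (parity_white n) => //; exact: parity_coloring.
Qed.

(* Hence the denominator of [placement_prob] is nonzero. *)
Lemma tilings_neq0 (R : realType) n : tilings R n !=set0.
Proof.
pose A := fset_set (aztec R n).
have inA s : (s \in A) = (`|2 * s.1 + 1| + `|2 * s.2 + 1| <= 2 * n%:Z).
  rewrite in_fset_set; last exact: finite_aztec.
  by apply/idP/idP => [/set_mem/aztecE|/aztecE/mem_set].
pose W (s : square) : bool := (2 %| s.1 + (if (0 <= s.2)%R then s.2 else - s.2 - 1)  + n%:Z)%Z.
exists [fset hspace s | s in [fset s in A | W s]%fset]%fset; split.
  move=> d /imfsetP [[i j]] /=; rewrite !inE /= inA /W /= => /andP[h w] ->.
  split; first by exists (i, j); left.
  move=> x; rewrite !inE => /orP[] /eqP ->; apply/aztecE => //=.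
  by move: w; case: ifP; lia.
move=> [i j] /aztecE /= h.
pose l : square := if W (i, j) then (i, j) else (i - 1, j).
have lA : l \in A by rewrite inA /l /W /=; case: ifP; case: ifP => /=; lia.
have lW : W l by rewrite /l; case: ifP => //; rewrite /W /=; case: ifP; lia.
exists (hspace l); split.
  split; first by apply/imfsetP; exists l => //; rewrite !inE lA lW.
  by rewrite /l; case: ifP => _; rewrite !inE /right_of /= ?subrK eqxx ?orbT.
move=> d [/imfsetP [[i' j']] /=]; rewrite !inE /= => /andP[_ w] -> .
rewrite !inE /right_of /= => /orP[] /eqP [e1 e2]; subst i j; congr hspace.
  by rewrite /l w.
rewrite /l ifF ?addrK //; move: w; rewrite /W /=; case: ifP; lia.
Qed.

(* Main.v *)
Require Import Defs.
From mathcomp Require Import all_boot all_order all_algebra finmap zify lra.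
From mathcomp Require Import all_classical all_reals all_analysis.
Import Order.TTheory GRing.Theory Num.Theory.
Import numFieldNormedType.Exports.
Local Open Scope classical_set_scope.
Local Open Scope ring_scope.

Set Implicit Arguments.
Unset Strict Implicit.
Unset Printing Implicit Defensive.

(* Idea of the proof. Cut the diamond of order [n.+1] into a checkerboard of
   2x2 cells, so that every domino lies in exactly one of them. A tiling of
   order [n] and one of order [n.+1] are both determined, up to flips of fully
   covered cells, by the set of squares that each cell covers by itself, and
   complementation of these sets exchanges the two orders. This gives a linear
   recursion for the placement probabilities, whose increments satisfy a
   discrete wave equation solved by products of two Krawtchouk coefficients.
   Hence, with [p] and [q] the distances of the location to the two upper
   sides of the diamond, the placement probability in order [n] is
   [\sum_(M < n) rho p q M], where [rho p q] is a probability distribution that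
   does not depend on [n].

   The transform [\sum_M rho p q M * z ^ M] is an explicit finite sum. At
   [z = exp (- k / n)] it tends, uniformly in [p, q <= n], to the average over
   [x] of [exp (- k * (2 (P + Q) + 2 sqrt (2 P Q) cos x))], where [P ~ p / n]
   and [Q ~ q / n]: under [rho p q], [M / n] has asymptotically an arcsine law.
   Approximating a step function by polynomials in [exp (- M / n)] gives the
   convergence of the distribution function at [M = n]; it is uniform as long as
   the arcsine law does not degenerate to a point mass at the threshold, which
   happens exactly at [(1/2, 1/2)] and [(- 1/2, 1/2)]. *)

(** * Tilings as local configurations on a checkerboard of cells *)

(** The cells overlap: a square of the diamond of order [n] lies in two of them, and a square that
    only order [n.+1] has lies in one. This double count is why complementing the covered set of
    every cell turns a cover of one order into a cover of the other. The weights [rho p q M]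
    oscillate with [M], so asymptotics of single terms, uniform in [p] and [q], would be delicate.
    Passing to the transform avoids them: it is a terminating hypergeometric sum, which converges to
    an exponential times a Bessel series. What the way back needs is that [rho] is nonnegative,
    which is not visible in a product of two signed coefficients and follows from the self-duality
    of Krawtchouk coefficients. The arcsine law appears because that Bessel series is the average of
    the exponential of a multiple of a cosine. Finite means over Chebyshev nodes represent this
    average, so that the limit is obtained by counting nodes on one side of the angle where the
    threshold is crossed. *)

Definition in_diamond (n : nat) (s : square) : bool :=
  `|2 * s.1 + 1| + `|2 * s.2 + 1| <= 2 * n%:Z.

(* Four booleans: either the dominoes contained in a cell, in the order
   ((bottom, top), (left, right)), or its corners, indexed by the two bits of
   the offset from the lower left one. *)
Definition quad := (bool * bool * (bool * bool))%type.

Definition bit (s : quad) (e : bool * bool) : bool :=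
  let h := if e.1 then s.2 else s.1 in if e.2 then h.2 else h.1.

(* [p] and [q] are the distances to the upper right and the upper left side. *)
Definition center (n p q : nat) : int * int := (q%:Z - p%:Z, n%:Z - p%:Z - q%:Z).

Definition corner (c : int * int) (k : bool * bool) : square :=
  (c.1 - 1 + k.1%:Z, c.2 - 1 + k.2%:Z).

Definition edge (c : int * int) (e : bool * bool) : {fset square} :=
  if e.1 then vspace (corner c (e.2, false)) else hspace (corner c (false, e.2)).

Lemma edge_corners c e v :
  (v \in edge c e) = (v == corner c (if e.1 then (e.2, false) else (false, e.2)))
                  || (v == corner c (if e.1 then (e.2, true) else (true, e.2))).
Proof.
case: e => [[] x]; rewrite /edge /= !inE; congr orb; congr (v == _);
  by rewrite /corner /above /right_of /=; congr (_, _); lia.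
Qed.

Lemma hspace_inj : injective hspace.
Proof.
move=> [i j] [i' j'] h.
have : (i, j) \in hspace (i', j') by rewrite -h !inE eqxx.
have : (i', j') \in hspace (i, j) by rewrite h !inE eqxx.
rewrite !inE /right_of !xpair_eqE /= => h1 h2; congr (_, _); lia.
Qed.

Lemma vspace_inj : injective vspace.
Proof.
move=> [i j] [i' j'] h.
have : (i, j) \in vspace (i', j') by rewrite -h !inE eqxx.
have : (i', j') \in vspace (i, j) by rewrite h !inE eqxx.
rewrite !inE /above !xpair_eqE /= => h1 h2; congr (_, _); lia.
Qed.

Lemma hspace_neq_vspace s s' : hspace s <> vspace s'.
Proof.
case: s s' => [i j] [i' j'] h.
have : (i, j) \in vspace (i', j') by rewrite -h !inE eqxx.
have : (i + 1, j) \in vspace (i', j') by rewrite -h !inE /right_of eqxx orbT.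
rewrite !inE /above !xpair_eqE /=; lia.
Qed.

Lemma edge_inj (n p q p' q' : nat) e e' :
  edge (center n p q) e = edge (center n p' q') e' -> [/\ p = p', q = q' & e = e'].
Proof.
case: e e' => [[] x] [[] x']; rewrite /edge /=.
- by move/vspace_inj; rewrite /corner /= => -[]; case: x; case: x' => /= h1 h2;
    (split; [lia|lia|]) => //; lia.
- by move/esym/hspace_neq_vspace.
- by move/hspace_neq_vspace.
- by move/hspace_inj; rewrite /corner /= => -[]; case: x; case: x' => /= h1 h2;
    (split; [lia|lia|]) => //; lia.
Qed.

Lemma center_surj (n : nat) (l m : int) :
  `|l| + `|m| <= n%:Z -> (2 %| l + m + n%:Z)%Z ->
  exists p : 'I_n.+1, exists q : 'I_n.+1, center n p q = (l, m).
Proof.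
move=> h1 h2.
have hp : (absz ((n%:Z - m - l) %/ 2)%Z < n.+1)%N by lia.
have hq : (absz ((n%:Z - m + l) %/ 2)%Z < n.+1)%N by lia.
exists (Ordinal hp), (Ordinal hq); rewrite /center /=; congr (_, _); lia.
Qed.

(** The side shared by the two squares has two ends of opposite parity; the end with the parity of
    [n] is the center of the cell that contains the domino. *)
Lemma edge_surj (n : nat) (d : {fset square}) s :
  d = hspace s \/ d = vspace s -> (forall v, v \in d -> in_diamond n.+1 v) ->
  exists p : 'I_n.+1, exists q : 'I_n.+1, exists e, d = edge (center n p q) e.
Proof.
case: s => i j; rewrite /in_diamond => -[] -> h.
  have h1 := h (i, j); have h2 := h (i + 1, j).
  rewrite !inE /right_of eqxx /= in h1; rewrite !inE /right_of eqxx orbT /= in h2.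
  have {}h1 := h1 isT; have {}h2 := h2 isT.
  have [m [x [hm1 hm2 hm3]]] : exists m : int, exists x : bool,
    [/\ `|i + 1| + `|m| <= n%:Z, (2 %| i + 1 + m + n%:Z)%Z & j = m - 1 + x%:Z].
    case: (boolP (2 %| i + 1 + j + n%:Z)%Z) => hj.
      by exists j, true; split; lia.
    by exists (j + 1), false; split; lia.
  have [p [q hc]] := center_surj hm1 hm2.
  exists p, q, (false, x); rewrite /edge hc /corner /=; congr hspace; congr (_, _); lia.
have h1 := h (i, j); have h2 := h (i, j + 1).
rewrite !inE /above eqxx /= in h1; rewrite !inE /above eqxx orbT /= in h2.
have {}h1 := h1 isT; have {}h2 := h2 isT.
have [l [x [hm1 hm2 hm3]]] : exists l : int, exists x : bool,
  [/\ `|l| + `|j + 1| <= n%:Z, (2 %| l + (j + 1) + n%:Z)%Z & i = l - 1 + x%:Z].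
  case: (boolP (2 %| i + (j + 1) + n%:Z)%Z) => hj.
    by exists i, true; split; lia.
  by exists (i + 1), false; split; lia.
have [p [q hc]] := center_surj hm1 hm2.
exists p, q, (true, x); rewrite /edge hc /corner /=; congr vspace; congr (_, _); lia.
Qed.

Definition config (n : nat) := {ffun 'I_n.+1 * 'I_n.+1 -> quad}.

Definition cell_center (n : nat) (c : 'I_n.+1 * 'I_n.+1) : int * int := center n c.1 c.2.

Definition covering (n : nat) (f : config n) (v : square) :=
  [pred x : ('I_n.+1 * 'I_n.+1) * (bool * bool) |
    bit (f x.1) x.2 && (v \in edge (cell_center x.1) x.2)].

(** [n] fixes the cells and [k] the diamond to be tiled. Only [k = n] and [k = n.+1] occur: both
    orders are described on the same cells so that they can be compared. *)
Definition valid (n k : nat) (f : config n) : bool :=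
  `[< forall v, #|covering f v| = in_diamond k v :> nat >].

Definition dominoes (n : nat) (f : config n) : {fset {fset square}} :=
  [fset edge (cell_center x.1) x.2 |
    x in [pred x : ('I_n.+1 * 'I_n.+1) * (bool * bool) | bit (f x.1) x.2]]%fset.

Lemma in_dominoes (n : nat) (f : config n) d :
  reflect (exists c e, d = edge (cell_center c) e /\ bit (f c) e) (d \in dominoes f).
Proof.
rewrite /dominoes; apply: (iffP (imfsetP _ _ _ _)) => /= [[[c e]] /= h ->|[c [e [-> h]]]];
  first by exists c, e.
by exists (c, e).
Qed.

Lemma edge_in_dominoes (n : nat) (f : config n) c e :
  (edge (cell_center c) e \in dominoes f) = bit (f c) e.
Proof.
apply/in_dominoes/idP => [[c' [e' [/edge_inj[h1 h2 ->] h]]]|h]; last by exists c, e.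
suff -> : c = c' by [].
by case: c c' h1 h2 {h} => [p q] [p' q'] /= /val_inj -> /val_inj ->.
Qed.

Lemma quadP (s s' : quad) : (forall e, bit s e = bit s' e) -> s = s'.
Proof.
case: s s' => [[a b] [c d]] [[a' b'] [c' d']] h.
move: (h (false, false)) (h (false, true)) (h (true, false)) (h (true, true)).
by rewrite /bit /= => -> -> -> ->.
Qed.

Lemma dominoes_inj (n : nat) : injective (@dominoes n).
Proof.
move=> f f' h; apply/ffunP => c; apply: quadP => e.
by rewrite -!edge_in_dominoes h.
Qed.

Definition quad_of (a : bool * bool -> bool) : quad :=
  ((a (false, false), a (false, true)), (a (true, false), a (true, true))).

Lemma at_quad_of a e : bit (quad_of a) e = a e.
Proof. by case: e => [[] []]. Qed.

Lemma in_diamondE (R : realType) n s : aztec R n s <-> in_diamond n s.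
Proof. exact: aztecE. Qed.

Lemma in_diamondS n v : in_diamond n v -> in_diamond n.+1 v.
Proof. rewrite /in_diamond; lia. Qed.

Lemma tilingsE (R : realType) (n k : nat) : (k == n) || (k == n.+1) ->
  tilings R k = @dominoes n @` [set f | valid k f].
Proof.
move=> hk; have sub v : in_diamond k v -> in_diamond n.+1 v.
  by case/orP: hk => /eqP -> //; exact: in_diamondS.
apply/seteqP; split => [t [ht tcov]|t [f /= /asboolP fv <-]].
  have surj d : d \in t -> exists c : 'I_n.+1 * 'I_n.+1, exists e, d = edge (cell_center c) e.
    move=> /ht [[s hs] hd].
    have [p [q [e ->]]] := @edge_surj n d s hs (fun v hv =>
      sub _ ((@in_diamondE R k v).1 (hd v hv))).
    by exists (p, q), e.
  pose f : config n := [ffun c => quad_of (fun e => edge (cell_center c) e \in t)].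
  have atf c e : bit (f c) e = (edge (cell_center c) e \in t) by rewrite ffunE at_quad_of.
  exists f; last first.
    apply/fsetP => d; apply/in_dominoes/idP => [[c [e [-> ]]]|dt]; first by rewrite atf.
    have [c [e he]] := surj _ dt; exists c, e; split => //.
    by rewrite atf -he.
  apply/asboolP => v; case: (boolP (in_diamond k v)) => hv /=.
    have [d [[dt vd] uniq]] := tcov v ((@in_diamondE R k v).2 hv).
    have [c [e he]] := surj _ dt.
    apply: (fintype.eq_card1 (x := (c, e))) => -[c' e'].
    rewrite !inE /=; apply/andP/eqP => [[]|[-> ->]]; last by rewrite atf -he.
    rewrite atf => h1 h2; have := uniq _ (conj h1 h2).
    rewrite he => /edge_inj[a b ->]; congr (_, _).
    by case: c c' a b {he h1 h2} => [p q] [p' q'] /= /val_inj -> /val_inj ->.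
  apply: fintype.eq_card0 => -[c e]; rewrite !inE /= atf; apply/negP => /andP[h1 h2].
  have [_ /(_ _ h2)] := ht _ h1; move/in_diamondE; exact/negP.
have dA d : d \in dominoes f -> forall v, v \in d -> in_diamond k v.
  move=> /in_dominoes[c [e [-> h]]] v vd.
  have : (0 < #|covering f v|)%N.
    by apply/card_gt0P; exists (c, e); rewrite !inE /= h.
  by rewrite fv; case: in_diamond.
split=> [d dd|v /in_diamondE hv].
  split; last by move=> s hs; apply/in_diamondE; exact: dA hs.
  case/in_dominoes: (dd) => c [e0 [-> _]]; case: e0 => o x.
  rewrite /edge /=; case: o; first by exists (corner (cell_center c) (x, false)); right.
  by exists (corner (cell_center c) (false, x)); left.
have := fv v; rewrite hv => /fintype.mem_card1 [[c e] hce].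
have := hce (c, e); rewrite !inE eqxx /= => /andP[h1 h2].
exists (edge (cell_center c) e); split; first by rewrite edge_in_dominoes.
move=> d' [/in_dominoes[c' [e' [-> h3]]] h4].
have := hce (c', e'); rewrite !inE /= h3 h4 /= => /esym.
by rewrite xpair_eqE => /andP[/eqP -> /eqP ->].
Qed.

Lemma card_tilings (R : realType) (n k : nat) (Q : pred {fset {fset square}}) :
  (k == n) || (k == n.+1) ->
  #|` fset_set [set t | tilings R k t /\ Q t]| =
  #|[pred f : config n | valid k f && Q (dominoes f)]|.
Proof.
move=> hk.
have -> : [set t | tilings R k t /\ Q t] =
    @dominoes n @` [set` [pred f : config n | valid k f && Q (dominoes f)]].
  rewrite (tilingsE R hk); apply/seteqP; split => [t [[f hf <-] hQ]|t [f /=]].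
    by exists f => //=; rewrite inE; apply/andP.
  by rewrite inE => /andP[h1 h2] <-; split => //; exists f.
rewrite fset_set_image; last exact: finite_finset.
rewrite card_imfset /=; last exact: dominoes_inj.
set P := [pred f : config n | _].
transitivity (#|` [fset x in P]%fset|); last by rewrite card_imfset //= -cardE.
congr (#|` _|); apply/fsetP => f.
rewrite in_fset_set; last exact: finite_finset.
rewrite !inE; apply/idP/idP => [/set_mem|h]; first by rewrite /= inE.
by apply/mem_set; rewrite /= inE.
Qed.

(** * Covered patterns of cells and their complements *)

Definition cover (s : quad) (k : bool * bool) : nat :=
  bit s (false, k.2) + bit s (true, k.1).

Definition legit (s : quad) : bool :=
  ~~ ((s.1.1 || s.1.2) && (s.2.1 || s.2.2)).

Definition pat (s : quad) : quad := quad_of (fun k => (0 < cover s k)%N).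

Definition covers (n k : nat) (g : config n) : bool :=
  `[< forall v, (\sum_c \sum_e (corner (cell_center c) e == v) * bit (g c) e)%N =
      in_diamond k v :> nat >].

Lemma big_bool2 (V : nmodType) (F : bool * bool -> V) :
  \sum_e F e = F (false, false) + F (false, true) + (F (true, false) + F (true, true)).
Proof.
rewrite (eq_bigr (fun e => F (e.1, e.2))) => [|[] //].
by rewrite -(pair_bigA _ (fun i j => F (i, j))) /= !big_bool /= addrC; congr (_ + _); rewrite addrC.
Qed.

Lemma corner_inj c : injective (corner c).
Proof. by move=> [a b] [a' b']; rewrite /corner /= => -[h1 h2]; congr (_, _); lia. Qed.

Lemma card_covering (n : nat) (f : config n) v :
  #|covering f v| = (\sum_c \sum_k (corner (cell_center c) k == v) * cover (f c) k)%N.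
Proof.
rewrite -sum1_card big_mkcond /= -(pair_bigA _ (fun c e =>
  if bit (f c) e && (v \in edge (cell_center c) e) then 1 else 0)%N) /=.
apply: eq_bigr => c _.
rewrite (big_bool2 (V := nat)) [RHS](big_bool2 (V := nat)) /= !edge_corners /=.
set A := corner _ (false, false); set B := corner _ (false, true).
set C := corner _ (true, false); set D := corner _ (true, true).
rewrite /cover /= ![v == _]eq_sym.
have ne x y : x != y -> ~~ ((corner (cell_center c) x == v) && (corner (cell_center c) y == v)).
  by move=> h; apply: contra h => /andP[/eqP <- /eqP/corner_inj ->].
move: (ne (false, false) (false, true) isT) (ne (false, false) (true, false) isT)
  (ne (false, false) (true, true) isT) (ne (false, true) (true, false) isT)
  (ne (false, true) (true, true) isT) (ne (true, false) (true, true) isT).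
rewrite -/A -/B -/C -/D.
by case: (A == v); case: (B == v); case: (C == v); case: (D == v) => //= *;
  case: (bit _ (false, false)); case: (bit _ (false, true));
  case: (bit _ (true, false)); case: (bit _ (true, true)).
Qed.

Lemma legitP s : reflect (forall k, (cover s k <= 1)%N) (legit s).
Proof.
case: s => [[a b] [c d]]; rewrite /legit /cover /=; apply: (iffP idP).
  by move=> h [[] []]; move: h; case: a; case: b; case: c; case: d.
move=> h; move: (h (false, false)) (h (false, true)) (h (true, false)) (h (true, true)).
by case: a {h}; case: b; case: c; case: d.
Qed.

Lemma validE (n k : nat) (f : config n) :
  valid k f = [forall c, legit (f c)] && covers k [ffun c => pat (f c)].
Proof.
have patE c : legit (f c) -> forall e, bit (pat (f c)) e = cover (f c) e :> nat.
  by move=> /legitP h e; rewrite at_quad_of; case: (cover (f c) e) (h e) => [|[]].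
apply/asboolP/andP => [h|[/forallP h1 /asboolP h2 v]].
  have hl c : legit (f c).
    apply/legitP => e; apply: (@leq_trans (in_diamond k (corner (cell_center c) e)));
      last by case: in_diamond.
    rewrite -h card_covering (bigD1 c) //= (bigD1 e) //= eqxx mul1n -addnA; exact: leq_addr.
  split; first exact/forallP.
  apply/asboolP => v; rewrite -h card_covering.
  by apply: eq_bigr => c _; apply: eq_bigr => e _; rewrite ffunE patE.
rewrite -h2 card_covering.
by apply: eq_bigr => c _; apply: eq_bigr => e _; rewrite ffunE patE.
Qed.

(** The local factor of the count: the number of ways to fill one cell, within the event [F], so
    that it covers exactly [g]. Without an event it is 2 for the full pattern, because of the flip,
    and at most 1 otherwise. *)
Definition wgt (R : realType) (F : pred quad) (g : quad) : R :=
  \sum_s (F s && legit s && (pat s == g))%:R.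

Lemma prod_bool (R : realType) (I : finType) (P : pred I) :
  \prod_(i : I) (P i)%:R = [forall i, P i]%:R :> R.
Proof.
case: (boolP [forall i, P i]) => [/forallP h|].
  by rewrite big1 // => i _; rewrite h.
by rewrite negb_forall => /existsP[i hi]; rewrite (bigD1 i) //= (negPf hi) mul0r.
Qed.

(** Validity depends on the cells only through their patterns. Once these are fixed, the cells are
    filled independently, which gives a sum of products. *)
Lemma card_valid (R : realType) (n k : nat) (F : 'I_n.+1 * 'I_n.+1 -> pred quad) :
  #|[pred f : config n | valid k f && [forall c, F c (f c)]]|%:R =
  \sum_(g : config n) (covers k g)%:R * \prod_c wgt R (F c) (g c).
Proof.
under [RHS]eq_bigr => g _ do rewrite /wgt bigA_distr_bigA /= mulr_sumr.
rewrite exchange_big /= -sum1_card natr_sum big_mkcond /=; apply: eq_bigr => f _.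
under eq_bigr => g _ do rewrite prod_bool.
rewrite (bigD1 [ffun c => pat (f c)]) //= [X in _ + X]big1 ?addr0; last first.
  move=> g hg; suff -> : [forall c, F c (f c) && legit (f c) && (pat (f c) == g c)] = false.
    by rewrite mulr0.
  apply/negbTE; apply: contra hg => /forallP h; apply/eqP/ffunP => c; rewrite ffunE.
  by have /andP[_ /eqP ->] := h c.
rewrite inE /= validE.
have -> : [forall i, F i (f i) && legit (f i) && (pat (f i) == [ffun c => pat (f c)] i)] =
   [forall c, legit (f c)] && [forall c, F c (f c)].
  apply/forallP/andP => [h|[/forallP h1 /forallP h2] c]; last by rewrite h1 h2 ffunE eqxx.
  by split; apply/forallP => c; have /andP[/andP[]] := h c.
by case: covers; case: [forall c, legit (f c)]; case: [forall c, F c (f c)]; rewrite /= ?mulr0 ?mul0r ?mul1r.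
Qed.

Definition neg (g : quad) : quad := quad_of (fun k => ~~ bit g k).

Lemma negK : involutive neg.
Proof. by case=> [[[] []] [[] []]]. Qed.

Definition negc (n : nat) (g : config n) : config n := [ffun c => neg (g c)].

Lemma negcK n : involutive (@negc n).
Proof. by move=> g; apply/ffunP => c; rewrite !ffunE negK. Qed.

Lemma sum_bool2 (F : bool * bool -> nat) : (\sum_e F e =
  F (false, false) + F (false, true) + (F (true, false) + F (true, true)))%N.
Proof. exact: (big_bool2 (V := nat)). Qed.

(** Two opposite corners of a square have the parity of cell centers. Both are in range for a square
    of order [n], and just one for a square that belongs to order [n.+1] only. *)
Lemma incidence (n : nat) (v : square) :
  (\sum_(c : 'I_n.+1 * 'I_n.+1) \sum_k (corner (cell_center c) k == v) =
   in_diamond n v + in_diamond n.+1 v)%N.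
Proof.
case: v => i j.
pose active (k : bool * bool) : bool :=
  let l := i + 1 - k.1%:Z in let m := j + 1 - k.2%:Z in
  (`|l| + `|m| <= n%:Z) && (2 %| l + m + n%:Z)%Z.
have one k : (\sum_(c : 'I_n.+1 * 'I_n.+1) (corner (cell_center c) k == (i, j)) = active k)%N.
  case: (boolP (active k)) => [/andP[h1 h2]|h].
    have [p [q hc]] := center_surj h1 h2.
    rewrite (bigD1 (p, q)) //= {1}/cell_center hc big1 ?addn0 => [|[p' q'] hne].
      have -> : corner (i + 1 - k.1%:Z, j + 1 - k.2%:Z) k = (i, j).
        by rewrite /corner /=; congr (_, _); lia.
      by rewrite eqxx.
    apply/eqP; rewrite eqb0; apply: contra hne => /eqP hv.
    move: hc hv; rewrite /cell_center /center /corner /= => -[e1 e2] [e3 e4].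
    by rewrite xpair_eqE -!val_eqE /=; lia.
  rewrite big1 // => -[p q] _; apply/eqP; rewrite eqb0; apply: contra h => /eqP hv.
  have hp := ltn_ord p; have hq := ltn_ord q.
  move: hv; rewrite /active /corner /cell_center /center /= => -[e1 e2]; lia.
rewrite exchange_big /= (eq_bigr _ (fun k _ => one k)) sum_bool2 /in_diamond.
clear one; rewrite [RHS]/=.
case: (boolP (2 %| i + j + n%:Z)%Z) => hij.
  have -> : active (false, false) = (`|i + 1| + `|j + 1| <= n%:Z) by rewrite /active /=; lia.
  have -> : active (false, true) = false by rewrite /active /=; lia.
  have -> : active (true, false) = false by rewrite /active /=; lia.
  have -> : active (true, true) = (`|i| + `|j| <= n%:Z) by rewrite /active /=; lia.
  clear active; rewrite [LHS]/= addn0 add0n.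
  (* Order [n] is decided by the farther of the two corners and order [n.+1] by the nearer one; in
     the first case their roles are exchanged. *)
  have [[hi hj]|h] : (i < 0 /\ j < 0) \/ (0 <= i \/ 0 <= j) by lia.
    by rewrite addnC; congr (nat_of_bool _ + nat_of_bool _)%N; lia.
  by congr (nat_of_bool _ + nat_of_bool _)%N; lia.
have -> : active (false, false) = false by rewrite /active /=; lia.
have -> : active (false, true) = (`|i + 1| + `|j| <= n%:Z) by rewrite /active /=; lia.
have -> : active (true, false) = (`|i| + `|j + 1| <= n%:Z) by rewrite /active /=; lia.
have -> : active (true, true) = false by rewrite /active /=; lia.
clear active; rewrite [LHS]/= addn0 add0n.
have [[hi hj]|h] : (i < 0 /\ 0 <= j) \/ (0 <= i \/ j < 0) by lia.
  by rewrite addnC; congr (nat_of_bool _ + nat_of_bool _)%N; lia.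
by congr (nat_of_bool _ + nat_of_bool _)%N; lia.
Qed.

Lemma covers_negc (n : nat) (g : config n) : covers n.+1 (negc g) = covers n g.
Proof.
have E v : (\sum_c \sum_e (corner (cell_center c) e == v) * bit (negc g c) e +
    \sum_c \sum_e (corner (cell_center c) e == v) * bit (g c) e =
    in_diamond n v + in_diamond n.+1 v)%N.
  rewrite -incidence -big_split /=; apply: eq_bigr => c _.
  rewrite -big_split /=; apply: eq_bigr => e _.
  by rewrite ffunE at_quad_of; case: (_ == v); case: bit.
by apply/asboolP/asboolP => h v; have := E v; rewrite h; lia.
Qed.

Definition sqrt2 (R : realType) : R := Num.sqrt 2.

Lemma sqr_sqrt2 (R : realType) : sqrt2 R ^+ 2 = 2.
Proof. by rewrite sqr_sqrtr. Qed.

Definition kappa (R : realType) (g : quad) : R :=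
  1 / 2 * sqrt2 R ^+ (\sum_e bit (neg g) e).

Lemma sum_quad (R : nmodType) (F : quad -> R) :
  \sum_s F s = \sum_h \sum_v F (h, v).
Proof.
rewrite (eq_bigr (fun s => F (s.1, s.2))) => [|[] //].
by rewrite -(pair_bigA _ (fun i j => F (i, j))).
Qed.

Lemma wgtE (R : realType) (F : pred quad) (g : quad) : wgt R F g =
  if g == neg (true, true, (true, true)) then (F (false, false, (false, false)))%:R
  else if g == (true, true, (true, true)) then
    (F (true, true, (false, false)))%:R + (F (false, false, (true, true)))%:R
  else if g == (true, false, (true, false)) then (F (true, false, (false, false)))%:R
  else if g == (false, true, (false, true)) then (F (false, true, (false, false)))%:R
  else if g == (true, true, (false, false)) then (F (false, false, (true, false)))%:R
  else if g == (false, false, (true, true)) then (F (false, false, (false, true)))%:R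
  else 0.
Proof.
rewrite /wgt sum_quad big_bool2 !big_bool2.
case: g => [[[] []] [[] []]] /=;
  by rewrite /legit /pat /quad_of /cover /bit /= ?andbF ?andbT !(addr0, add0r) // addrC.
Qed.

(** Domino shuffling inside one cell: an empty cell becomes full and receives either pair of
    parallel dominoes, a single domino moves to the opposite side, and for a full cell, which
    becomes empty, the terms on the right cancel. All other patterns have weight zero. *)
Lemma wgt_neg (R : realType) (g : quad) (e : bool * bool) :
  2 * wgt R (fun s => bit s e) (neg g) =
  kappa R g * (wgt R predT g + wgt R (fun s => bit s (e.1, ~~ e.2)) g
    - wgt R (fun s => bit s e) g - wgt R (fun s => bit s (~~ e.1, false)) g
    - wgt R (fun s => bit s (~~ e.1, true)) g).
Proof.
rewrite !wgtE /kappa (big_bool2 (V := nat)).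
have h2 := sqr_sqrt2 R.
have h4 : sqrt2 R ^+ 4 = 4 by rewrite (exprM _ 2 2) h2; lra.
by case: e => [[] []]; case: g => [[[] []] [[] []]]; rewrite /= ?h4 ?h2 ?expr0; lra.
Qed.

Lemma wgt_negT (R : realType) (g : quad) :
  wgt R predT (neg g) = kappa R g * wgt R predT g.
Proof.
rewrite !wgtE /kappa (big_bool2 (V := nat)).
have h2 := sqr_sqrt2 R.
have h4 : sqrt2 R ^+ 4 = 4 by rewrite (exprM _ 2 2) h2; lra.
by case: g => [[[] []] [[] []]]; rewrite /= ?h4 ?h2 ?expr0; lra.
Qed.

(* The weights of complementary patterns differ by a power of [sqrt 2] whose
   exponent is the number of covered squares, and the total number of those is
   the area of the diamond. *)
Lemma kappa_prod (R : realType) (n : nat) :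
  exists2 K : R, 0 < K & forall g : config n, covers n g -> \prod_c kappa R (g c) = K.
Proof.
pose V := undup [seq corner (cell_center x.1) x.2 |
  x <- enum {: ('I_n.+1 * 'I_n.+1) * (bool * bool)}].
exists ((1 / 2) ^+ #|{: 'I_n.+1 * 'I_n.+1}| *
        sqrt2 R ^+ (\sum_(v <- V) in_diamond n.+1 v)).
  by rewrite mulr_gt0 ?exprn_gt0 // ?sqrtr_gt0; lra.
move=> g hg; rewrite /kappa big_split /= prodr_const; congr (_ * _).
rewrite prodrXr; congr (_ ^+ _).
have /asboolP hn : covers n.+1 (negc g) by rewrite covers_negc.
under [RHS]eq_bigr => v _ do rewrite -hn.
rewrite [RHS]exchange_big /=; apply: eq_bigr => c _.
rewrite [RHS]exchange_big /=; apply: eq_bigr => e _.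
rewrite ffunE -big_distrl /=.
have hin : corner (cell_center c) e \in V.
  by rewrite mem_undup; apply/mapP; exists (c, e) => //; rewrite mem_enum.
have -> : (\sum_(i <- V) (corner (cell_center c) e == i) = count_mem (corner (cell_center c) e) V)%N.
  by rewrite -sum1_count [RHS]big_mkcond /=; apply: eq_bigr => i _; rewrite eq_sym.
by rewrite count_uniq_mem ?undup_uniq // hin mul1n.
Qed.

(** * Domino shuffling and the wave equation *)

Definition events (n : nat) (c0 : 'I_n.+1 * 'I_n.+1) (F : pred quad)
  (c : 'I_n.+1 * 'I_n.+1) : pred quad := if c == c0 then F else predT.

Definition no_event (n : nat) (_ : 'I_n.+1 * 'I_n.+1) : pred quad := predT.

Definition weight (R : realType) (n k : nat) (F : 'I_n.+1 * 'I_n.+1 -> pred quad) : R :=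
  \sum_(g : config n) (covers k g)%:R * \prod_c wgt R (F c) (g c).

Lemma placement_probE (R : realType) (n k : nat) c e : (k == n) || (k == n.+1) ->
  placement_prob R k (edge (@cell_center n c) e) =
  weight R k (events c (fun s => bit s e)) /
  weight R k (@no_event n).
Proof.
move=> hk; rewrite /placement_prob /weight -!card_valid; congr (_%:R / _%:R).
  rewrite (card_tilings R (fun t => edge (cell_center c) e \in t) hk).
  apply: eq_card => f; rewrite !inE edge_in_dominoes; congr (_ && _).
  apply/idP/forallP => [h c'|/(_ c)]; last by rewrite /events eqxx.
  by rewrite /events; case: eqP => // ->.
have -> : tilings R k = [set t | tilings R k t /\ predT t] by apply/seteqP; split=> [t|t []].
rewrite (card_tilings R predT hk).
by apply: eq_card => f; rewrite !inE; congr (_ && _); apply/esym/forallP.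
Qed.

Lemma weight_neq0 (R : realType) (n : nat) :
  weight R n (@no_event n) != 0.
Proof.
rewrite /weight -card_valid pnatr_eq0 -lt0n.
have [t ht] := tilings_neq0 R n.
have := ht; rewrite (@tilingsE R n n) ?eqxx // => -[f /= fv _].
by apply/card_gt0P; exists f; rewrite inE fv; apply/forallP.
Qed.

Lemma weightS (R : realType) (n : nat) : exists2 K : R, K != 0 &
  weight R n.+1 (@no_event n) =
    K * weight R n (@no_event n) /\
  forall c e, 2 * weight R n.+1 (@events n c (fun s => bit s e)) =
    K * (weight R n (@no_event n)
      + weight R n (events c (fun s => bit s (e.1, ~~ e.2)))
      - weight R n (events c (fun s => bit s e))
      - weight R n (events c (fun s => bit s (~~ e.1, false)))
      - weight R n (events c (fun s => bit s (~~ e.1, true)))).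
Proof.
have [K K0 hK] := kappa_prod R n; exists K; first by rewrite gt_eqF.
have reindex_neg F : weight R n.+1 F =
    \sum_(g : config n) (covers n g)%:R * \prod_c wgt R (F c) (neg (g c)).
  rewrite /weight (reindex_inj (inv_inj (@negcK n))) /=.
  apply: eq_bigr => g _; rewrite covers_negc; congr (_ * _).
  by apply: eq_bigr => c _; rewrite ffunE.
split.
  rewrite reindex_neg /weight big_distrr /=; apply: eq_bigr => g _.
  case: (boolP (covers n g)) => hg; last by rewrite !mul0r mulr0.
  rewrite !mul1r -(hK _ hg) -big_split /=.
  by apply: eq_bigr => c _; rewrite wgt_negT.
move=> c e; rewrite reindex_neg /weight -big_split /= -!sumrB !big_distrr /=.
apply: eq_bigr => g _.
case: (boolP (covers n g)) => hg; last by rewrite !mul0r !(mulr0, subr0, addr0).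
rewrite !mul1r -(hK _ hg).
rewrite !(bigD1 (P := predT) c) //=.
have E F : \prod_(i | i != c) wgt R (events c F i) (g i) =
    \prod_(i | i != c) wgt R predT (g i).
  by apply: eq_bigr => i hi; rewrite /events (negPf hi).
have E' F : \prod_(i | i != c) wgt R (events c F i) (neg (g i)) =
    (\prod_(i | i != c) kappa R (g i)) * \prod_(i | i != c) wgt R predT (g i).
  rewrite -big_split /=; apply: eq_bigr => i hi.
  by rewrite /events (negPf hi) wgt_negT.
rewrite E' !E /events !eqxx mulrA wgt_neg.
set A := \prod_(_ | _) kappa R _; set B := \prod_(_ | _) _.
lra.
Qed.

Lemma placement_prob_rec (R : realType) (n : nat) (c : 'I_n.+1 * 'I_n.+1) e :
  placement_prob R n.+1 (edge (cell_center c) e) = 1 / 2 *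
    (1 + placement_prob R n (edge (cell_center c) (e.1, ~~ e.2))
     - placement_prob R n (edge (cell_center c) e)
     - placement_prob R n (edge (cell_center c) (~~ e.1, false))
     - placement_prob R n (edge (cell_center c) (~~ e.1, true))).
Proof.
rewrite !(@placement_probE R n) ?eqxx ?orbT //.
have [K K0 [-> /(_ c e)]] := weightS R n.
set W := weight R n (@no_event n) => h.
have W0 : W != 0 by exact: weight_neq0.
have W1 : W * W^-1 = 1 by rewrite divff.
have K1 : K * K^-1 = 1 by rewrite divff.
set A := weight R n.+1 _ in h *; rewrite invfM.
set B := (X in K * X) in h.
have -> : A * (K^-1 * W^-1) = 1 / 2 * (2 * A * K^-1 * W^-1) by lra.
rewrite h.
have -> : K * B * K^-1 * W^-1 = (K * K^-1) * (B * W^-1) by lra.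
by rewrite K1 /B; lra.
Qed.

Lemma placement_prob_out (R : realType) n d :
  ~ domino_space R n d -> placement_prob R n d = 0.
Proof.
move=> h; rewrite /placement_prob.
have -> : [set t | tilings R n t /\ d \in t] = set0.
  by apply/seteqP; split=> // t [[/(_ d) ht _] /ht].
by rewrite fset_set0 cardfs0 mul0r.
Qed.

Lemma placement_prob_square (R : realType) n (i j : int) :
  placement_prob R n (hspace (i, j)) + placement_prob R n (hspace (i - 1, j)) +
  placement_prob R n (vspace (i, j)) + placement_prob R n (vspace (i, j - 1)) =
  (in_diamond n (i, j))%:R.
Proof.
case: (boolP (in_diamond n (i, j))) => hij; last first.
  have edges_out d : (i, j) \in d -> placement_prob R n d = 0.
    move=> hd; apply: placement_prob_out => -[_ /(_ _ hd)].
    by move/in_diamondE; exact/negP.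
  by rewrite !edges_out ?addr0 // !inE /right_of /above ?subrK eqxx ?orbT.
have count d : #|` fset_set [set t | tilings R n t /\ d \in t]|%:R =
    \sum_(f : config n) (valid n f && (d \in dominoes f))%:R :> R.
  rewrite (@card_tilings R n n (fun t => d \in t)) ?eqxx //.
  rewrite -sum1_card natr_sum big_mkcond; apply: eq_bigr => f _.
  by rewrite inE; case: (_ && _).
have all_count : #|` fset_set (tilings R n)|%:R = \sum_(f : config n) (valid n f)%:R :> R.
  have -> : tilings R n = [set t | tilings R n t /\ predT t] by apply/seteqP; split=> [t|t []].
  rewrite (@card_tilings R n n predT) ?eqxx // -sum1_card natr_sum big_mkcond.
  by apply: eq_bigr => f _; rewrite inE andbT; case: valid.
have Z0 : #|` fset_set (tilings R n)|%:R != 0 :> R.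
  rewrite pnatr_eq0 cardfs_eq0; apply/negP => /eqP h0.
  have [t ht] := tilings_neq0 R n.
  have : t \in fset_set (tilings R n) by rewrite in_fset_set ?inE //; exact: finite_tilings.
  by rewrite h0 inE.
have P d : placement_prob R n d =
    (\sum_(f : config n) (valid n f && (d \in dominoes f))%:R) / (\sum_(f : config n) (valid n f)%:R).
  by rewrite /placement_prob; congr (_ / _); [exact: count | exact: all_count].
rewrite {}all_count in Z0; rewrite !{}P -!mulrDl; apply: (mulIf Z0); rewrite divfK // mul1r.
transitivity (\sum_(f : config n) ((valid n f && (hspace (i, j) \in dominoes f))%:R +
    (valid n f && (hspace (i - 1, j) \in dominoes f))%:R +
    (valid n f && (vspace (i, j) \in dominoes f))%:R +
    (valid n f && (vspace (i, j - 1) \in dominoes f))%:R : R)).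
  by rewrite !big_split.
apply: eq_bigr => f _.
case: (boolP (valid n f)) => fv; rewrite /= ?addr0 //.
have : tilings R n (dominoes f) by rewrite (@tilingsE R n n) ?eqxx //; exists f.
move=> [ht /(_ _ ((@in_diamondE R n (i, j)).2 hij)) [d [[dt vd] uniq]]].
set D := dominoes f in ht dt uniq *.
have U (d' : {fset square}) : (i, j) \in d' -> (d' \in D) = (d' == d).
  by move=> hd'; apply/idP/eqP => [h|-> //]; apply/esym/uniq.
rewrite !U ?inE /right_of /above ?subrK ?eqxx ?orbT //.
have n1 : hspace (i, j) != hspace (i - 1, j) by apply/eqP => /hspace_inj[]; lia.
have n2 : vspace (i, j) != vspace (i, j - 1) by apply/eqP => /vspace_inj[]; lia.
have n3 s s' : hspace s != vspace s' by apply/eqP => /hspace_neq_vspace.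
have : d \in [:: hspace (i, j); hspace (i - 1, j); vspace (i, j); vspace (i, j - 1)].
  have [[[i' j'] hd] _] := ht _ dt; case: hd vd => ->; rewrite !inE => /orP[] /eqP[-> ->];
    by rewrite ?addrK !eqxx ?orbT.
have n4 s s' : vspace s != hspace s' by rewrite eq_sym n3.
rewrite !inE => /or4P[] /eqP ->.
- by rewrite eqxx [hspace (i - 1, j) == _]eq_sym (negPf n1) !(negPf (n4 _ _)) !addr0.
- by rewrite eqxx (negPf n1) !(negPf (n4 _ _)) !addr0 add0r.
- by rewrite eqxx [vspace (i, j - 1) == _]eq_sym (negPf n2) !(negPf (n3 _ _)) !addr0 !add0r.
- by rewrite eqxx (negPf n2) !(negPf (n3 _ _)) !add0r.
Qed.

#[local] Opaque placement_prob.

Ltac decide_comparison :=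
  match goal with
  | |- context [(?a <= ?b)%R] =>
    first [have -> : (a <= b)%R = true by lia | have -> : (a <= b)%R = false by lia]
  | |- context [(?a < ?b)%R] =>
    first [have -> : (a < b)%R = true by lia | have -> : (a < b)%R = false by lia]
  end.

Section Fields.
Variable R : realType.

(** Two fields describe all four edges of a cell: its bottom edge is the top edge seen from
    [(l, m - 1)], and its left edge the right edge seen from [(l - 1, m)]. These points are centers
    of the neighbouring orders. *)
Definition top_prob n (l m : int) : R := placement_prob R n (hspace (l - 1, m)).
Definition right_prob n (l m : int) : R := placement_prob R n (vspace (l, m - 1)).

Definition edge_sum n (l m : int) : R :=
  top_prob n l m + top_prob n l (m - 1) + right_prob n l m + right_prob n (l - 1) m.

Definition region (n : nat) (l m : int) : bool := `|l| + `|m| <= n%:Z.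

(* The net creation rate of domino shuffling in passing from order [n] to [n.+1]. *)
Definition creation n (l m : int) : R := (region n l m)%:R - edge_sum n l m.

Lemma edge_top (l m : int) : edge (l, m) (false, true) = hspace (l - 1, m).
Proof. by rewrite /edge /corner /=; congr hspace; congr (_, _); lia. Qed.
Lemma edge_bottom (l m : int) : edge (l, m) (false, false) = hspace (l - 1, m - 1).
Proof. by rewrite /edge /corner /=; congr hspace; congr (_, _); lia. Qed.
Lemma edge_left (l m : int) : edge (l, m) (true, false) = vspace (l - 1, m - 1).
Proof. by rewrite /edge /corner /=; congr vspace; congr (_, _); lia. Qed.
Lemma edge_right (l m : int) : edge (l, m) (true, true) = vspace (l, m - 1).
Proof. by rewrite /edge /corner /=; congr vspace; congr (_, _); lia. Qed.

Lemma hspace_out n (i j : int) : ~~ (in_diamond n (i, j) && in_diamond n (i + 1, j)) ->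
  placement_prob R n (hspace (i, j)) = 0.
Proof.
move=> h; apply: placement_prob_out => -[_ hd]; move/negP: h; apply; apply/andP.
by split; apply/(in_diamondE R)/hd; rewrite !inE /right_of eqxx ?orbT.
Qed.

Lemma vspace_out n (i j : int) : ~~ (in_diamond n (i, j) && in_diamond n (i, j + 1)) ->
  placement_prob R n (vspace (i, j)) = 0.
Proof.
move=> h; apply: placement_prob_out => -[_ hd]; move/negP: h; apply; apply/andP.
by split; apply/(in_diamondE R)/hd; rewrite !inE /above eqxx ?orbT.
Qed.

Lemma edges_out n (l m : int) : n%:Z < `|l| + `|m| ->
  [/\ top_prob n l m = 0, top_prob n l (m - 1) = 0, right_prob n l m = 0 & right_prob n (l - 1) m = 0].
Proof.
move=> h; rewrite /top_prob /right_prob.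
by split; [apply: hspace_out|apply: hspace_out|apply: vspace_out|apply: vspace_out];
  rewrite /in_diamond /=; lia.
Qed.

Lemma creation_rec n (l m : int) : (2 %| l + m + n%:Z)%Z ->
  [/\ top_prob n.+1 l m = top_prob n l (m - 1) + 1 / 2 * creation n l m,
      top_prob n.+1 l (m - 1) = top_prob n l m + 1 / 2 * creation n l m,
      right_prob n.+1 l m = right_prob n (l - 1) m + 1 / 2 * creation n l m
    & right_prob n.+1 (l - 1) m = right_prob n l m + 1 / 2 * creation n l m].
Proof.
move=> hp; rewrite /creation /edge_sum; case: (boolP (region n l m)) => hr.
  have [p [q hc]] := center_surj hr hp.
  have := fun e => placement_prob_rec R (p, q) e; rewrite /cell_center /= hc => rec.
  have := rec (false, true); have := rec (false, false).
  have := rec (true, true); have := rec (true, false).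
  rewrite /= !edge_top !edge_bottom !edge_left !edge_right /top_prob /right_prob.
  move: (placement_prob R n.+1 _) (placement_prob R n.+1 _)
    (placement_prob R n.+1 _) (placement_prob R n.+1 _) => w1 w2 w3 w4.
  move: (placement_prob R n _) (placement_prob R n _)
    (placement_prob R n _) (placement_prob R n _) => u1 u2 u3 u4.
  by move=> -> -> -> ->; split; lra.
have hn : n.+1%:Z < `|l| + `|m| by move: hr; rewrite /region; lia.
have [-> -> -> ->] := edges_out hn.
have hn' : n%:Z < `|l| + `|m| by lia.
by have [-> -> -> ->] := edges_out hn'; rewrite ?(negPf hr) /=; split; rewrite ?addr0 ?subr0 ?mulr0 ?addr0.
Qed.

Lemma square_sum n (i j : int) :
  top_prob n (i + 1) j + top_prob n i j + right_prob n i (j + 1) + right_prob n i j =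
  (in_diamond n (i, j))%:R.
Proof.
rewrite -placement_prob_square /top_prob /right_prob !addrK.
by [].
Qed.

Ltac linear_in_fields :=
  clear; repeat match goal with
  | |- context [top_prob ?n ?a ?b] => generalize (top_prob n a b); intro
  | |- context [right_prob ?n ?a ?b] => generalize (right_prob n a b); intro
  | |- context [creation ?n ?a ?b] => generalize (creation n a b); intro
  | |- context [(nat_of_bool ?b)%:R] => generalize (nat_of_bool b)%:R; intro
  end; lra.

#[local] Opaque top_prob right_prob.

Lemma region_count n (l m : int) : (2 %| l + m + n.+1%:Z)%Z ->
  (region n.+1 l m + in_diamond n (l, m) + in_diamond n (l - 1, m)%R +
    in_diamond n (l, m - 1)%R + in_diamond n (l - 1, m - 1)%R =
  region n (l + 1)%R m + region n (l - 1)%R m + region n l (m + 1)%R + region n l (m - 1)%R +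
    (`|l| + `|m| < n%:Z)%R)%N.
Proof.
move=> hp; rewrite /region /in_diamond /=.
(* Parity excludes the values [n] and [n + 2]. *)
have [hs|[hs|hs]] : `|l| + `|m| < n%:Z \/ `|l| + `|m| = n%:Z + 1 \/ n%:Z + 3 <= `|l| + `|m|
  by lia.
- by clear hp; repeat decide_comparison.
- clear hp; have [hl|[hl|hl]] : 0 < l \/ l < 0 \/ l = 0 by lia.
  + have [hm|[hm|hm]] : 0 < m \/ m < 0 \/ m = 0 by lia.
    * by repeat decide_comparison.
    * by repeat decide_comparison.
    * by repeat decide_comparison.
  + have [hm|[hm|hm]] : 0 < m \/ m < 0 \/ m = 0 by lia.
    * by repeat decide_comparison.
    * by repeat decide_comparison.
    * by repeat decide_comparison.
  + have [hm|[hm|hm]] : 0 < m \/ m < 0 \/ m = 0 by lia.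
    * by repeat decide_comparison.
    * by repeat decide_comparison.
    * by exfalso; lia.
- by clear hp; repeat decide_comparison.
Qed.

(** Each of the four edges at [(l, m)] is an edge of a cell of order [n] centered at a neighbour of
    [(l, m)], so [creation_rec] applies to it there. The equations [square_sum] of the four squares
    around [(l, m)] then eliminate all outer dominoes, and the indicators combine by
    [region_count]. *)
Lemma creation_step n (l m : int) : (2 %| l + m + n.+1%:Z)%Z ->
  creation n.+1 l m = 1 / 2 * (creation n (l + 1) m + creation n (l - 1) m +
    creation n l (m + 1) + creation n l (m - 1)) - edge_sum n l m
    + (`|l| + `|m| < n%:Z)%R%:R.
Proof.
move=> hp.
have ind : (region n.+1 l m)%:R - (region n (l + 1) m)%:R - (region n (l - 1) m)%:R
  - (region n l (m + 1))%:R - (region n l (m - 1))%:R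
  + (in_diamond n (l, m))%:R + (in_diamond n (l - 1, m))%:R
  + (in_diamond n (l, m - 1))%:R + (in_diamond n (l - 1, m - 1))%:R = (`|l| + `|m| < n%:Z)%R%:R :> R.
  move: (region_count hp) => /(congr1 (fun k => k%:R : R)); rewrite !natrD; lra.
have [a1 _ _ _] := @creation_rec n l (m - 1) ltac:(lia).
have [_ a2 _ _] := @creation_rec n l (m + 1) ltac:(lia).
have [_ _ a3 _] := @creation_rec n (l - 1) m ltac:(lia).
have [_ _ _ a4] := @creation_rec n (l + 1) m ltac:(lia).
have v1 := square_sum n l m; have v2 := square_sum n (l - 1) m.
have v3 := square_sum n l (m - 1); have v4 := square_sum n (l - 1) (m - 1).
rewrite !(addrK, subrK) in a1 a2 a3 a4 v1 v2 v3 v4.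
rewrite {1}/creation {1}/edge_sum a1 a2 a3 a4.
move: ind v1 v2 v3 v4; rewrite /creation /edge_sum !(addrK, subrK).
linear_in_fields.
Qed.

Lemma edge_sumS n (l m : int) : (2 %| l + m + n%:Z)%Z ->
  edge_sum n.+1 l m = (region n l m)%:R + creation n l m.
Proof.
move=> /creation_rec[a b c d]; rewrite /edge_sum a b c d /creation /edge_sum.
by linear_in_fields.
Qed.

(** One more step of shuffling expresses the remaining [edge_sum] of order [n.+1] by [region] and
    [creation] of order [n]. The indicator then cancels, which leaves a homogeneous equation. *)
Lemma creation_wave n (l m : int) : (2 %| l + m + n%:Z)%Z ->
  creation n.+2 l m = 1 / 2 * (creation n.+1 (l + 1) m + creation n.+1 (l - 1) m +
    creation n.+1 l (m + 1) + creation n.+1 l (m - 1)) - creation n l m.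
Proof.
move=> hp; rewrite creation_step; last lia.
have -> : (`|l| + `|m| < n.+1%:Z) = region n l m by rewrite /region; lia.
rewrite edge_sumS //; linear_in_fields.
Qed.

#[local] Transparent top_prob right_prob.

Lemma edge_sum0 (l m : int) : edge_sum 0 l m = 0.
Proof.
rewrite /edge_sum /top_prob /right_prob !(hspace_out, vspace_out) ?addr0 // /in_diamond /=; lia.
Qed.

Lemma creation0 (l m : int) : creation 0 l m = ((l == 0) && (m == 0))%:R.
Proof. by rewrite /creation edge_sum0 subr0 /region; congr (nat_of_bool _)%:R; lia. Qed.

Lemma creation1 (l m : int) : (2 %| l + m + 1)%Z ->
  creation 1 l m = 1 / 2 * (creation 0 (l + 1) m + creation 0 (l - 1) m +
    creation 0 l (m + 1) + creation 0 l (m - 1)).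
Proof.
move=> hp; rewrite creation_step; last lia.
have -> : (`|l| + `|m| < 0%:Z) = false by lia.
by rewrite edge_sum0 subr0 addr0.
Qed.

Lemma creation_out n (l m : int) : n%:Z < `|l| + `|m| -> creation n l m = 0.
Proof.
move=> h; have [h1 h2 h3 h4] := edges_out h.
rewrite /creation /edge_sum h1 h2 h3 h4 !addr0 subr0.
by have -> : region n l m = false by rewrite /region; lia.
Qed.

#[local] Opaque creation.

(** A north-going domino moves up by one unit per step of the shuffling. Iterating [creation_rec]
    back along this vertical path collects half the net creation rate at every order passed. *)
Lemma top_sum n (l m : int) : (2 %| l + m + n%:Z)%Z ->
  top_prob n.+1 l m = 1 / 2 * \sum_(M < n.+1) creation M l (m + M%:Z - n%:Z).
Proof.
elim: n m => [|n IH] m hp; have [-> _ _ _] := creation_rec hp.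
  have -> : top_prob 0 l (m - 1) = 0 by rewrite /top_prob hspace_out // /in_diamond /=; lia.
  rewrite big_ord1 add0r.
  by have -> : m + Posz (@ord0 0) - 0%N%:Z = m by rewrite /=; lia.
rewrite big_ord_recr /= [RHS]mulrDr IH; last by lia.
have -> : m + n.+1%:Z - n.+1%:Z = m by lia.
rewrite [in LHS](eq_bigr (fun M : 'I_n.+1 => creation M l (m + M%:Z - n.+1%:Z))) => [//|i _].
by have -> : m - 1 + i%:Z - n%:Z = m + i%:Z - n.+1%:Z by lia.
Qed.

End Fields.

(** * Krawtchouk coefficients *)

#[local] Opaque creation.

Section Krawtchouk.
Variable R : realType.

Definition kraw (n a b : nat) : R := ((1 - 'X) ^+ b * (1 + 'X) ^+ (n - b) : {poly R})`_a.

(** The cutoff matters: for [b > n] the truncated difference [n - b] is zero and [kraw n a b] is a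
    coefficient of [(1 - 'X) ^+ b], whereas the creation rate vanishes there. *)
Definition kraw_prod (n a b : nat) : R :=
  if (a <= n)%N && (b <= n)%N then kraw n a b * kraw n b a else 0.

Lemma kraw_low n b a : (b <= n)%N -> kraw n.+1 a.+1 b = kraw n a.+1 b + kraw n a b.
Proof.
move=> h; rewrite /kraw subSn // exprSr mulrA mulrDr mulr1 coefD coefMX /=.
by [].
Qed.

Lemma kraw_high n a b : kraw n.+1 a.+1 b.+1 = kraw n a.+1 b - kraw n a b.
Proof.
rewrite /kraw subSS exprSr -mulrA [(1 - 'X) * _]mulrC mulrA mulrBr mulr1 coefB coefMX /=.
by [].
Qed.

Lemma kraw0 n b : kraw n 0 b = 1.
Proof. by rewrite /kraw -horner_coef0 !hornerE ?(subr0, addr0, oppr0) !expr1n ?mulr1. Qed.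

Lemma kraw_gt n a b : (b <= n)%N -> (n < a)%N -> kraw n a b = 0.
Proof.
elim: n a b => [|n IH] [|a] [|b] // hb ha.
- by rewrite /kraw expr0 mulr1 coef1.
- by rewrite kraw_low // !IH ?addr0 //; lia.
- by rewrite kraw_high !IH ?subr0 //; lia.
Qed.

Lemma kraw_b0 n a : kraw n a 0 = 'C(n, a)%:R.
Proof.
elim: n a => [|n IH] [|a]; rewrite ?kraw0 ?bin0 //.
  by rewrite kraw_gt.
by rewrite kraw_low // !IH binS natrD.
Qed.

Lemma kraw_lead n b : (b <= n)%N -> kraw n n b = (-1) ^+ b.
Proof.
elim: n b => [|n IH] [|b] // hb; rewrite ?kraw0 //.
  by rewrite kraw_low // kraw_gt // IH // add0r.
by rewrite kraw_high kraw_gt // IH // exprS; lra.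
Qed.

Lemma kraw_bn n a : kraw n a n = (-1) ^+ a * 'C(n, a)%:R.
Proof.
elim: n a => [|n IH] [|a]; rewrite ?kraw0 ?bin0 ?expr0 ?mulr1 //.
  by rewrite kraw_gt // bin0n mulr0.
by rewrite kraw_high !IH binS natrD exprS; lra.
Qed.

Lemma kraw_prodC n a b : kraw_prod n a b = kraw_prod n b a.
Proof. by rewrite /kraw_prod andbC mulrC. Qed.

Lemma kraw_prod0 n b : kraw_prod n 0 b = 'C(n, b)%:R.
Proof.
rewrite /kraw_prod /= kraw0 kraw_b0 mul1r; case: leqP => // h.
by rewrite bin_small.
Qed.

Lemma kraw_prodn n a : kraw_prod n a n = 'C(n, a)%:R.
Proof.
rewrite /kraw_prod leqnn andbT; case: leqP => h; last by rewrite bin_small.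
by rewrite kraw_bn kraw_lead // mulrAC -exprD addnn -mul2n exprM sqrrN expr1n expr1n mul1r.
Qed.

(** In the bulk the two recursions of Pascal type reduce every factor to coefficients of order [n],
    and a polynomial identity remains. On the border [b = n.+1] the products are binomial
    coefficients and the identity is Pascal's rule; the border [a = n.+1] follows by symmetry. *)
Lemma kraw_prod_wave n a b :
  kraw_prod n.+2 a.+1 b.+1 = kraw_prod n.+1 a.+1 b.+1 + kraw_prod n.+1 a b.+1 +
    kraw_prod n.+1 a.+1 b + kraw_prod n.+1 a b - 4 * kraw_prod n a b.
Proof.
have zero m x y : (m < y)%N -> kraw_prod m x y = 0.
  by move=> h; rewrite /kraw_prod [(y <= m)%N]leqNgt h andbF.
have edge x : kraw_prod n.+2 x.+1 n.+2 = kraw_prod n.+1 x.+1 n.+2 + kraw_prod n.+1 x n.+2 +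
    kraw_prod n.+1 x.+1 n.+1 + kraw_prod n.+1 x n.+1 - 4 * kraw_prod n x n.+1.
  rewrite (zero n.+1 x.+1) // (zero n.+1 x) // (zero n) // !kraw_prodn binS natrD; lra.
have zero' m x y : (m < y)%N -> kraw_prod m y x = 0 by move=> h; rewrite kraw_prodC zero.
case: (ltngtP b n.+1) => hb; last by rewrite hb edge.
  case: (ltngtP a n.+1) => ha; last first.
  - rewrite ha kraw_prodC edge ![kraw_prod _ b.+1 _]kraw_prodC ![kraw_prod _ b _]kraw_prodC; lra.
  - rewrite !zero'; [lra|lia..].
  rewrite !ltnS in ha hb.
  rewrite /kraw_prod !ltnS ha hb (leqW ha) (leqW hb) /=.
  rewrite ![kraw n.+2 _ _]kraw_low ?ltnS //.
  pose r x y := if x is x'.+1 then kraw n x' y else 0 : R.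
  have low x y : (y <= n)%N -> kraw n.+1 x y = kraw n x y + r x y.
    by case: x => [|x] h; rewrite /r ?kraw0 ?addr0 // kraw_low.
  have high x y : kraw n.+1 x y.+1 = kraw n x y - r x y.
    by case: x => [|x]; rewrite /r ?kraw0 ?subr0 // kraw_high.
  rewrite !high !low //=.
  lra.
rewrite !zero; [lra|lia..].
Qed.

(** The left side is the coefficient of [x^a y^b] in [(1 + x + y - x y)^n], which is symmetric in
    [x] and [y]. The induction uses the recursion [rec] of these coefficients. *)
Lemma kraw_dual n a b : 'C(n, b)%:R * kraw n a b = 'C(n, a)%:R * kraw n b a.
Proof.
have rec m x y : 'C(m.+1, y.+1)%:R * kraw m.+1 x.+1 y.+1 =
   'C(m, y.+1)%:R * kraw m x.+1 y.+1 + 'C(m, y.+1)%:R * kraw m x y.+1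
   + 'C(m, y)%:R * kraw m x.+1 y - 'C(m, y)%:R * kraw m x y.
  rewrite binS natrD mulrDl {2}kraw_high.
  case: (leqP y.+1 m) => h; first by rewrite kraw_low //; lra.
  by rewrite (bin_small h) !mul0r; lra.
elim: n a b => [|n IH] a b.
  case: a b => [|a] [|b] //; rewrite ?kraw0 ?kraw_b0 ?bin0 ?mulr1 ?mul1r //.
  by rewrite !bin0n !mul0r.
case: a b => [|a] [|b]; rewrite ?kraw0 ?kraw_b0 ?bin0 ?mulr1 ?mul1r //.
by rewrite !rec; move: (IH a.+1 b.+1) (IH a b.+1) (IH a.+1 b) (IH a b); lra.
Qed.

(** By duality, ['C(n, a)] times the product is ['C(n, b)] times the square of [kraw n a b]. *)
Lemma kraw_prod_ge0 n a b : 0 <= kraw_prod n a b.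
Proof.
rewrite /kraw_prod; case: ifP => // /andP[ha hb].
have hc : 0 < 'C(n, a)%:R :> R by rewrite ltr0n bin_gt0.
rewrite -(pmulr_rge0 _ hc) mulrCA -kraw_dual mulrCA -expr2.
by rewrite mulr_ge0 ?sqr_ge0 // ler0n.
Qed.

(** Seen from [(p, q)], the four neighbours in the preceding order are [(p - 1, q)], [(p, q - 1)],
    [(p - 1, q - 1)] and [(p, q)], and two orders back the same point is [(p - 1, q - 1)]. With the
    powers of 2, [creation_wave] thus becomes [kraw_prod_wave]. Neighbours with a negative
    coordinate lie outside the diamond. *)
Lemma creation_kraw M (p q : nat) :
  creation R M (q%:Z - p%:Z) (M%:Z - p%:Z - q%:Z) = kraw_prod M p q / 2 ^+ M.
Proof.
have wave0 n p' q' : kraw_prod n.+1 0 q'.+1 = kraw_prod n 0 q'.+1 + kraw_prod n 0 q' /\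
    kraw_prod n.+1 p'.+1 0 = kraw_prod n p'.+1 0 + kraw_prod n p' 0.
  by split; rewrite ?[kraw_prod _ _ 0]kraw_prodC !kraw_prod0 binS natrD.
have zero n p' q' : ((n < p') || (n < q'))%N -> kraw_prod n p' q' = 0.
  by rewrite /kraw_prod !ltnNge -negb_and => /negPf ->.
have base p' q' : creation R 0 (q'%:Z - p'%:Z) (0%N%:Z - p'%:Z - q'%:Z) =
    kraw_prod 0 p' q' / 2 ^+ 0.
  rewrite creation0 expr0 divr1.
  case: (boolP ((0 < p')%N || (0 < q')%N)) => h.
    by rewrite zero // (_ : _ && _ = false) //; lia.
  by case: p' q' h => [|p'] [|q'] //; rewrite kraw_prod0.
have step n p' q' l m : l = q'%:Z - p'%:Z -> m = n.+1%:Z - p'%:Z - q'%:Z ->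
    (forall p q, creation R n (q%:Z - p%:Z) (n%:Z - p%:Z - q%:Z) = kraw_prod n p q / 2 ^+ n) ->
    creation R n (l + 1) m + creation R n (l - 1) m +
      creation R n l (m + 1) + creation R n l (m - 1) =
    ((if p' is x.+1 then kraw_prod n x q' else 0) +
     (if q' is y.+1 then kraw_prod n p' y else 0) +
     (if p' is x.+1 then if q' is y.+1 then kraw_prod n x y else 0 else 0) +
     kraw_prod n p' q') / 2 ^+ n.
  move=> -> -> IH; rewrite !mulrDl; congr (_ + _ + _ + _).
  - case: p' => [|x]; first by rewrite mul0r creation_out //; lia.
    by rewrite -IH; congr creation; lia.
  - case: q' => [|y]; first by rewrite mul0r creation_out //; lia.
    by rewrite -IH; congr creation; lia.
  - case: p' => [|x]; first by rewrite mul0r creation_out //; lia.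
    case: q' => [|y]; first by rewrite mul0r creation_out //; lia.
    by rewrite -IH; congr creation; lia.
  - by rewrite -IH; congr creation; lia.
elim/ltn_ind: M p q => -[|[|M]] IH p q; first exact: base.
  rewrite creation1; last lia.
  rewrite (step 0%N p q) // expr0 divr1 expr1 mulrC mul1r; congr (_ / _).
  case: p q => [|p] [|q]; rewrite ?(addr0, add0r).
  - by rewrite !kraw_prod0.
  - by rewrite (wave0 0%N 0%N q).1 (zero 0%N 0%N q.+1) // add0r.
  - by rewrite (wave0 0%N p 0%N).2 (zero 0%N p.+1 0%N) // add0r.
  - case: p q => [|p] [|q]; first by rewrite ?(zero 0%N 0%N 1%N) // ?add0r !kraw_prodn.
    + by rewrite !zero ?addr0 //; lia.
    + by rewrite !zero ?addr0 //; lia.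
    + by rewrite !zero ?addr0 //; lia.
rewrite creation_wave; last lia.
rewrite (step M.+1 p q) //; last by move=> *; apply: IH.
case: p q => [|p] [|q]; rewrite ?(addr0, add0r).
- rewrite creation_out; last lia.
  by rewrite !kraw_prod0 !bin0 [in RHS]exprS subr0 invfM; lra.
- rewrite creation_out; last lia.
  by rewrite (wave0 M.+1 0%N q).1 [in RHS]exprS subr0 invfM; lra.
- rewrite creation_out; last lia.
  by rewrite (wave0 M.+1 p 0%N).2 [in RHS]exprS subr0 invfM; lra.
- have E : creation R M (q.+1%:Z - p.+1%:Z) (M.+2%:Z - p.+1%:Z - q.+1%:Z) =
      kraw_prod M p q / 2 ^+ M.
    by apply: etrans (IH M (ltnW (ltnSn M.+1)) p q); congr creation; lia.
  rewrite E.
  rewrite kraw_prod_wave !exprS !invfM; lra.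
Qed.

End Krawtchouk.

(** * The generating function of the creation rates *)

Section GeneratingFunction.
Variable R : realType.

Definition rho (p q M : nat) : R := kraw_prod R M p q / 2 ^+ M / 2.

Lemma rho_ge0 p q M : 0 <= rho p q M.
Proof. by rewrite /rho !divr_ge0 ?kraw_prod_ge0 // exprn_ge0. Qed.

(** The upper sides of the diamond rise as fast as a north-going domino does, so [p] and [q] stay
    constant along its path. This is why the summand does not involve [n]. *)
Lemma top_rho n (p q : nat) :
  top_prob R n.+1 (q%:Z - p%:Z) (n%:Z - p%:Z - q%:Z) = \sum_(M < n.+1) rho p q M.
Proof.
rewrite top_sum; last by lia.
rewrite mulr_sumr; apply: eq_bigr => M _.
rewrite [RHS]mulrC mul1r; congr (_ * _); rewrite -creation_kraw; congr creation; lia.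
Qed.

(** The terminating hypergeometric function [2F1(- p, - q; 1; y)]. *)
Definition hyp (p q : nat) (y : R) : R :=
  \sum_(j < p.+1) 'C(p, j)%:R * 'C(q, j)%:R * y ^+ j.

Lemma hypE K p q y : (p < K)%N ->
  hyp p q y = \sum_(j < K) 'C(p, j)%:R * 'C(q, j)%:R * y ^+ j.
Proof.
move=> h; rewrite /hyp -!(big_mkord predT (fun j => 'C(p, j)%:R * 'C(q, j)%:R * y ^+ j)).
rewrite [RHS](big_cat_nat (n := p.+1)) //= [X in _ + X]big_nat_cond.
rewrite [X in _ + X]big1 ?addr0 // => j /andP[/andP[hj _] _].
by rewrite bin_small // !mul0r.
Qed.

Lemma hyp_rec p q y :
  hyp p.+1 q.+1 y = hyp p q.+1 y + hyp p.+1 q y - (1 - y) * hyp p q y.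
Proof.
suff : hyp p.+1 q.+1 y - hyp p q.+1 y - hyp p.+1 q y + hyp p q y = y * hyp p q y by lra.
rewrite [X in _ = y * X]/hyp mulr_sumr.
rewrite !(@hypE p.+2) ?(ltnW (ltnSn _)) // -!sumrB -big_split /= big_ord_recl !bin0 !expr0.
rewrite [X in X + _](_ : _ = 0) ?add0r; last by lra.
apply: eq_bigr => i _; rewrite /bump /= ?add1n !binS !natrD exprS; lra.
Qed.

Lemma hyp0l q y : hyp 0 q y = 1.
Proof. by rewrite /hyp big_ord1 !bin0 expr0 !mulr1. Qed.

Lemma hyp0r p y : hyp p 0 y = 1.
Proof.
rewrite /hyp big_ord_recl !bin0 expr0 !mulr1 big1 ?addr0 // => i _.
by rewrite bin0n /= mulr0 mul0r.
Qed.

(** The first two factors solve the recursion for [p = 0]. Dividing by them turns the general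
    recursion into [hyp_rec], provided that [z / (2 - z) * (1 - y) = 2 * z - 1]; this determines the
    argument [y] of [hyp]. *)
Definition rho_gen (z : R) (p q : nat) : R :=
  1 / (2 - z) * (z / (2 - z)) ^+ (p + q) * hyp p q (2 * (1 - z) ^+ 2 / z).

Definition rho_sum (z : R) (p q K : nat) : R := \sum_(M < K) rho p q M * z ^+ M.

Lemma rho0 p q : rho p q 0 = ((p == 0%N) && (q == 0%N))%:R / 2.
Proof.
rewrite /rho expr0 divr1 /kraw_prod; case: p q => [|p] [|q] //=.
by rewrite kraw0 mulr1.
Qed.

Lemma rho_rec0 q M : rho 0 q.+1 M.+1 = 1 / 2 * (rho 0 q.+1 M + rho 0 q M).
Proof. by rewrite /rho !kraw_prod0 binS natrD exprS invfM; lra. Qed.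

Lemma rhoC p q M : rho p q M = rho q p M.
Proof. by rewrite /rho kraw_prodC. Qed.

Lemma rho_rec p q M : rho p.+1 q.+1 M.+2 =
  1 / 2 * (rho p.+1 q.+1 M.+1 + rho p q.+1 M.+1 + rho p.+1 q M.+1 + rho p q M.+1) - rho p q M.
Proof. by rewrite /rho kraw_prod_wave !exprS !invfM; lra. Qed.

Lemma rho_rec1 p q : rho p.+1 q.+1 1 = 1 / 2 * rho p q 0.
Proof.
rewrite rho0 /rho /kraw_prod; case: p q => [|p] [|q]; rewrite ?mul0r ?mulr0 //=.
by rewrite !kraw_bn binn !expr1; lra.
Qed.

Lemma rho_sumS z p q K : rho_sum z p q K.+1 =
  rho p q 0 + z * \sum_(M < K) rho p q M.+1 * z ^+ M.
Proof.
rewrite /rho_sum big_ord_recl expr0 mulr1 mulr_sumr; congr (_ + _).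
by apply: eq_bigr => i _; rewrite /= /bump ?add1n exprS mulrCA.
Qed.

Lemma rho_sum_rec00 z K : rho_sum z 0 0 K.+1 = z / 2 * rho_sum z 0 0 K + 1 / 2.
Proof.
rewrite rho_sumS rho0 addrC /= -mulrA; congr (_ * _ + _).
rewrite /rho_sum mulr_sumr; apply: eq_bigr => i _.
by rewrite /rho !kraw_prod0 !bin0 exprS invfM; lra.
Qed.

Lemma rho_sum_rec0 z q K :
  rho_sum z 0 q.+1 K.+1 = z / 2 * rho_sum z 0 q.+1 K + z / 2 * rho_sum z 0 q K.
Proof.
rewrite rho_sumS rho0 /= mul0r add0r -mulrDr -mulrA; congr (_ * _).
rewrite /rho_sum -big_split mulr_sumr; apply: eq_bigr => i _ /=.
by rewrite rho_rec0; lra.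
Qed.

Lemma rho_sum_rec z p q K :
  rho_sum z p.+1 q.+1 K.+2 = z / 2 * rho_sum z p.+1 q.+1 K.+1 +
    (z / 2 * (rho_sum z p q.+1 K.+1 + rho_sum z p.+1 q K.+1 + rho_sum z p q K.+1)
     - z ^+ 2 * rho_sum z p q K).
Proof.
rewrite rho_sumS [rho _ _ _]rho0 mul0r add0r big_ord_recl expr0 mulr1 rho_rec1 /=.
rewrite !rho_sumS !rho0 /= !andbF /= !mul0r !add0r.
suff -> : \sum_(i < K) rho p.+1 q.+1 (bump 0 i).+1 * z ^+ bump 0 i =
   1 / 2 * (z * (\sum_(M < K) rho p.+1 q.+1 M.+1 * z ^+ M) +
     z * (\sum_(M < K) rho p q.+1 M.+1 * z ^+ M) +
     z * (\sum_(M < K) rho p.+1 q M.+1 * z ^+ M) +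
     z * (\sum_(M < K) rho p q M.+1 * z ^+ M)) - z * rho_sum z p q K.
  by lra.
rewrite /rho_sum !mulr_sumr -!big_split /= mulr_sumr -sumrB; apply: eq_bigr => i _.
by rewrite /bump ?add1n rho_rec exprS; lra.
Qed.

(** Monotonicity turns the recursion into [(1 - c) * u K <= g K], so [u] is bounded and converges;
    its limit is the fixed point. *)
Lemma cvg_affine_rec (u g : nat -> R) (c G : R) : c < 1 ->
  nondecreasing_seq u -> (forall K, u K.+1 = c * u K + g K) -> g @ \oo --> G ->
  u @ \oo --> G / (1 - c).
Proof.
move=> c1 umon urec gG.
have [B hB] : has_ubound (range g).
  have /cvg_seq_bounded[B [_ hB]] : cvgn g by apply/cvg_ex; exists G.
  exists (B + 1) => _ [K _ <-].
  by apply: le_trans (ler_norm _) _; apply: hB => //; rewrite ltrDl.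
have ucv : cvgn u.
  apply: nondecreasing_is_cvgn => //; exists (B / (1 - c)) => _ [K _ <-].
  rewrite ler_pdivlMr ?subr_gt0 //.
  have := umon K K.+1 (leqnSn K); rewrite urec.
  have : g K <= B by apply: hB; exists K.
  lra.
have h1 : (fun K => u K.+1) @ \oo --> limn u by rewrite cvg_shiftS.
have h2 : (fun K => u K.+1) @ \oo --> c * limn u + G.
  under eq_fun do rewrite urec.
  by apply: cvgD => //; apply: cvgMr.
have E : limn u = c * limn u + G by apply: (cvg_unique _ h1 h2).
suff -> : G / (1 - c) = limn u by [].
apply: (mulIf (_ : 1 - c != 0)); first by rewrite gt_eqF // subr_gt0.
by rewrite divfK ?gt_eqF ?subr_gt0 //; lra.
Qed.

Lemma rho_sum_homo z p q : 0 <= z -> nondecreasing_seq (rho_sum z p q).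
Proof.
move=> z0; apply/nondecreasing_seqP => K; rewrite /rho_sum big_ord_recr /= lerDl.
by rewrite mulr_ge0 ?rho_ge0 ?exprn_ge0.
Qed.

(** Partial sums satisfy the recursion of the generating function with the number of terms shifted,
    so convergence propagates by induction on [p] and [q]. Nonnegativity of [rho] supplies the
    monotonicity, and even [z = 1] is covered. *)
Lemma rho_sum_cvg (z : R) p q : 0 < z -> z <= 1 ->
  rho_sum z p q @ \oo --> rho_gen z p q.
Proof.
move=> z0 z1; have hc : z / 2 < 1 by lra.
have hz : 2 - z != 0 by rewrite gt_eqF; lra.
have hz' : 1 - z / 2 != 0 by rewrite gt_eqF; lra.
have hz2 : (2 - z) * (2 - z)^-1 = 1 by rewrite divff.
have zi : z * z^-1 = 1 by rewrite divff // gt_eqF.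
have homo p' q' := @rho_sum_homo z p' q' (ltW z0).
have case0 q' : rho_sum z 0 q' @ \oo --> rho_gen z 0 q'.
  elim: q' => [|q' IH].
    have -> : rho_gen z 0 0 = (1 / 2) / (1 - z / 2).
      rewrite /rho_gen hyp0l expr0 !mulr1; apply: (mulIf hz'); rewrite divfK //; lra.
    by apply: (cvg_affine_rec hc (homo _ _) (rho_sum_rec00 z)); exact: cvg_cst.
  have -> : rho_gen z 0 q'.+1 = (z / 2 * rho_gen z 0 q') / (1 - z / 2).
    rewrite /rho_gen !hyp0l !mulr1 !add0n exprS; apply: (mulIf hz'); rewrite divfK //.
    set E := _ ^+ q'; move: hz2; set w := (2 - z)^-1 => hz2.
    have -> : 1 * w * (z * w * E) * (1 - z / 2) = 1 / 2 * w * z * E * ((2 - z) * w) by lra.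
    by rewrite hz2; lra.
  apply: (cvg_affine_rec hc (homo _ _) (rho_sum_rec0 z q')).
  exact: cvgMr.
elim: p q => [|p IHp] q; first exact: case0.
elim: q => [|q IHq].
  have -> : rho_gen z p.+1 0 = rho_gen z 0 p.+1 by rewrite /rho_gen hyp0l hyp0r addn0.
  by have := case0 p.+1; rewrite /rho_sum; under eq_fun do under eq_bigr do rewrite rhoC.
have -> : rho_gen z p.+1 q.+1 = (z / 2 * (rho_gen z p q.+1 + rho_gen z p.+1 q + rho_gen z p q)
   - z ^+ 2 * rho_gen z p q) / (1 - z / 2).
  rewrite /rho_gen hyp_rec addSn !addnS (exprS _ (p + q).+1) !(exprS _ (p + q)).
  apply: (mulIf hz'); rewrite divfK //.
  set E := _ ^+ (p + q); set y := 2 * (1 - z) ^+ 2 / z.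
  have yz : y * z = 2 * (1 - z) ^+ 2 by rewrite /y -mulrA [z^-1 * z]mulrC zi mulr1.
  set h1 := hyp p q.+1 _; set h2 := hyp p.+1 q _; set h3 := hyp p q _.
  move: hz2; set w := (2 - z)^-1 => hz2.
  apply/eqP; rewrite -subr_eq0; apply/eqP.
  have hw : w * z = 2 * w - 1 by lra.
  have key : z * w * (1 - y) = 2 * z - 1.
    have -> : z * w * (1 - y) = w * z - w * (y * z) by lra.
    rewrite yz.
    have -> : w * z - w * (2 * (1 - z) ^+ 2) = (2 * z - 1) * ((2 - z) * w) by lra.
    by rewrite hz2 mulr1.
  have -> : 1 * w * (z * w * (z * w * E)) * (h1 + h2 - (1 - y) * h3) * (1 - z / 2) =
    1 / 2 * w * z * E * (z * w * h1 + z * w * h2 - (z * w * (1 - y)) * h3) * ((2 - z) * w) by lra.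
  by rewrite hz2 key; lra.
rewrite -(cvg_shiftS (rho_sum z p.+1 q.+1)).
apply: (cvg_affine_rec hc _ (rho_sum_rec z p q)).
  by move=> i j ij; apply: homo.
have sh (u : nat -> R) l : u @ \oo --> l -> (fun K => u K.+1) @ \oo --> l by rewrite cvg_shiftS.
apply: cvgB; last exact: cvgMr.
apply: cvgMr; apply: cvgD; last exact: sh.
by apply: cvgD; apply: sh.
Qed.

End GeneratingFunction.

(** * Averages over Chebyshev nodes *)

Section ExponentialPartialSums.
Variable R : realType.

Definition exp_sum (K : nat) (x : R) : R := \sum_(j < K) x ^+ j / j`!%:R.

Lemma exp_sum_cvg x : exp_sum ^~ x @ \oo --> expR x.
Proof.
have -> : exp_sum ^~ x = series (exp_coeff x).
  by apply/funext => K; rewrite /exp_sum /series /= big_mkord.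
exact: is_cvg_series_exp_coeff.
Qed.

Lemma exp_sumS K x : exp_sum K.+1 x = exp_sum K x + x ^+ K / K`!%:R.
Proof. by rewrite /exp_sum big_ord_recr. Qed.

Lemma exp_sumB_le (x C : R) K N : `|x| <= C -> (K <= N)%N ->
  `|exp_sum N x - exp_sum K x| <= exp_sum N C - exp_sum K C.
Proof.
move=> xC; elim: N => [|N IH]; first by rewrite leqn0 => /eqP ->; rewrite !subrr normr0.
rewrite leq_eqVlt => /predU1P[->|]; first by rewrite !subrr normr0.
rewrite ltnS => /IH {}IH; rewrite !exp_sumS.
have h : `|x ^+ N / N`!%:R| <= C ^+ N / N`!%:R.
  rewrite normrM normrX [X in _ * X]ger0_norm ?invr_ge0 ?ler0n //.
  by rewrite ler_wpM2r ?invr_ge0 ?ler0n // lerXn2r ?nnegrE // (le_trans _ xC).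
have := ler_normD (exp_sum N x - exp_sum K x) (x ^+ N / N`!%:R).
rewrite (_ : exp_sum N x - exp_sum K x + x ^+ N / N`!%:R =
  exp_sum N x + x ^+ N / N`!%:R - exp_sum K x); last lra.
lra.
Qed.

Lemma exp_sum_le (x : R) K : 0 <= x -> exp_sum K x <= expR x.
Proof.
move=> x0; rewrite -(cvg_lim (@Rhausdorff R) (exp_sum_cvg (x := x))).
apply: nondecreasing_cvgn_le; last by apply/cvg_ex; exists (expR x); exact: exp_sum_cvg.
apply/nondecreasing_seqP => N; rewrite /exp_sum big_ord_recr lerDl /=.
by rewrite divr_ge0 ?exprn_ge0 // ler0n.
Qed.

Definition exp_tail (K : nat) (C : R) : R := expR C - exp_sum K C.

Lemma exp_sum_tail (x C : R) K : `|x| <= C -> `|expR x - exp_sum K x| <= exp_tail K C.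
Proof.
move=> xC.
have h1 : (fun N => `|exp_sum N x - exp_sum K x|) @ \oo --> `|expR x - exp_sum K x|.
  by apply: cvg_norm; apply: cvgB; [exact: exp_sum_cvg | exact: cvg_cst].
have h2 : (fun N => exp_sum N C - exp_sum K C) @ \oo --> exp_tail K C.
  by apply: cvgB; [exact: exp_sum_cvg | exact: cvg_cst].
rewrite -(cvg_lim (@Rhausdorff R) h1) -(cvg_lim (@Rhausdorff R) h2).
apply: ler_lim; [by apply/cvg_ex; eexists; exact: h1|by apply/cvg_ex; eexists; exact: h2|].
near=> N; apply: exp_sumB_le => //; near: N; exact: nbhs_infty_ge.
Unshelve. all: by end_near. Qed.

Lemma exp_tail_cvg C : exp_tail ^~ C @ \oo --> (0 : R).
Proof.
rewrite -[X in _ --> X](subrr (expR C)).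
by apply: cvgB; [exact: cvg_cst | exact: exp_sum_cvg].
Qed.

End ExponentialPartialSums.

Section Nodes.
Variable R : realType.

Definition theta (L i : nat) : R := pi * (i%:R + 1 / 2) / L%:R.

(** The midpoint rule on the interval from 0 to [pi], which is exact for polynomials in the cosine
    of degree below [2 * L]. *)
Definition mean (L : nat) (f : R -> R) : R := (\sum_(i < L) f (theta L i)) / L%:R.

Lemma sin_natpi m : sin (m%:R * pi) = 0 :> R.
Proof.
elim: m => [|m IH]; first by rewrite mul0r sin0.
by rewrite -natr1 mulrDl mul1r sinD IH sinpi mul0r mulr0 addr0.
Qed.

(** Multiplied by [2 * sin h], with [h] half the angular step, the sum telescopes to a sine at a
    multiple of [pi]. The bound on [m] keeps [sin h] positive. *)
Lemma sum_cos_theta L m : (0 < m)%N -> (m < 2 * L)%N ->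
  \sum_(i < L) cos (m%:R * theta L i) = 0.
Proof.
move=> m0 mL; have L0 : (0 < L)%N by lia.
have Li : L%:R * L%:R^-1 = 1 :> R by rewrite divff // pnatr_eq0 -lt0n.
have Lp : 0 < (L%:R)^-1 :> R by rewrite invr_gt0 ltr0n.
pose h : R := m%:R * pi / (2 * L%:R).
have hE : h = m%:R * pi * L%:R^-1 / 2 by rewrite /h invfM; lra.
have s0 : 0 < sin h.
  apply: sin_gt0_pi; rewrite /h divr_gt0 ?mulr_gt0 ?pi_gt0 ?ltr0n //=.
  rewrite ltr_pdivrMr ?mulr_gt0 ?ltr0n // mulrC ltr_pM2l ?pi_gt0 //.
  by rewrite -natrM ltr_nat.
pose g (i : nat) : R := sin (2 * i%:R * h).
have tel i : 2 * sin h * cos (m%:R * theta L i) = g i.+1 - g i.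
  have -> : m%:R * theta L i = 2 * i%:R * h + h.
    by rewrite hE /theta; lra.
  rewrite /g -[i.+1%:R]natr1 (_ : 2 * (i%:R + 1) * h = 2 * i%:R * h + h + h); last lra.
  set a := 2 * i%:R * h + h.
  rewrite (_ : 2 * i%:R * h = a - h); last by rewrite /a; lra.
  by rewrite [sin (a + h)]sinD [sin (a - h)]sinB; lra.
apply: (mulfI (_ : 2 * sin h != 0)); first by rewrite mulf_neq0 // gt_eqF.
rewrite mulr0 mulr_sumr; under eq_bigr => i _ do rewrite tel.
rewrite -(big_mkord predT (fun i => g i.+1 - g i)).
rewrite telescope_sumr // /g mulr0 mul0r sin0 subr0.
have -> : 2 * L%:R * h = m%:R * pi * (L%:R * L%:R^-1) by rewrite hE; lra.
by rewrite Li mulr1 sin_natpi.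
Qed.

(** The shift [t] makes the induction go through; the powers themselves are the case [t = 0]. *)
Lemma cos_pow (m : nat) (x t : R) : 2 ^+ m * (cos x ^+ m * cos (t * x)) =
  \sum_(k < m.+1) 'C(m, k)%:R * cos ((t + m%:R - 2 * k%:R) * x).
Proof.
elim: m t => [|m IH] t.
  by rewrite big_ord1 /= bin0 !expr0 !mul1r mulr0 addr0 subr0.
have -> : 2 ^+ m.+1 * (cos x ^+ m.+1 * cos (t * x)) =
    2 ^+ m * (cos x ^+ m * cos ((t + 1) * x)) + 2 ^+ m * (cos x ^+ m * cos ((t - 1) * x)).
  by rewrite mulrDl mulrBl mul1r cosD cosB !exprS; lra.
rewrite !IH [RHS]big_ord_recl /=.
rewrite [in RHS](eq_bigr (fun k : 'I_m.+1 =>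
    'C(m, k.+1)%:R * cos ((t + 1 + m%:R - 2 * k.+1%:R) * x) +
    'C(m, k)%:R * cos ((t - 1 + m%:R - 2 * k%:R) * x))); last first.
  move=> k _; rewrite /bump ?add1n binS natrD mulrDl.
  by congr (_ * cos (_ * x) + _ * cos (_ * x)); rewrite -?[m.+1%:R]natr1 -?[k.+1%:R]natr1; lra.
rewrite big_split /= addrA; congr (_ + _).
rewrite [LHS]big_ord_recl [in RHS]big_ord_recr /= (bin_small (ltnSn m)) mul0r addr0.
rewrite !bin0; by congr (_ * cos (_ * x) + _); rewrite -[m.+1%:R]natr1; lra.
Qed.

Lemma mean_cos_pow L m : (m < 2 * L)%N -> mean L (fun x => cos x ^+ m) =
  if odd m then 0 else 'C(m, m./2)%:R / 2 ^+ m.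
Proof.
move=> mL; have L0 : (0 < L)%N by lia.
have Li : L%:R != 0 :> R by rewrite pnatr_eq0 -lt0n.
have two : 2 ^+ m != 0 :> R by rewrite expf_neq0.
apply: (mulfI two); apply: (mulIf Li); rewrite -mulrA divfK //.
have -> : 2 ^+ m * \sum_(i < L) cos (theta L i) ^+ m =
    \sum_(k < m.+1) 'C(m, k)%:R * \sum_(i < L) cos ((m%:R - 2 * k%:R) * theta L i).
  rewrite mulr_sumr; under [RHS]eq_bigr => k _ do rewrite mulr_sumr.
  rewrite exchange_big /=; apply: eq_bigr => i _.
  have := cos_pow m (theta L i) 0; rewrite mul0r cos0 mulr1 => ->.
  by apply: eq_bigr => k _; rewrite add0r.
have zero (k : nat) : (k <= m)%N -> m != k.*2 ->
    \sum_(i < L) cos ((m%:R - 2 * k%:R) * theta L i) = 0.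
  move=> km mk; case: (leqP k.*2 m) => h.
    rewrite (_ : m%:R - 2 * k%:R = (m - k.*2)%:R); last by rewrite natrB // -mul2n natrM.
    by apply: sum_cos_theta; lia.
  under eq_bigr => i _ do rewrite -cosN -mulNr opprB.
  rewrite (_ : 2 * k%:R - m%:R = (k.*2 - m)%:R); last by rewrite natrB 1?ltnW // -mul2n natrM.
  by apply: sum_cos_theta; lia.
case: ifP => hm.
  rewrite mulr0 mul0r big1 // => k _; rewrite zero ?mulr0 //; first by have := ltn_ord k; lia.
  by apply: contraTneq hm => ->; rewrite odd_double.
have hk : (m./2 < m.+1)%N by lia.
rewrite (bigD1 (Ordinal hk)) //= [X in _ + X]big1 ?addr0; last first.
  move=> k hne; rewrite zero ?mulr0 //; first by have := ltn_ord k; lia.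
  apply: contra hne => /eqP h; rewrite -val_eqE /= ; lia.
rewrite (_ : m%:R - 2 * (m./2)%:R = 0); last first.
  by rewrite -natrM mul2n -{1}(odd_double_half m) hm add0n subrr.
under eq_bigr => i _ do rewrite mul0r cos0.
rewrite sumr_const card_ord -mulr_natl mulr1 [2 ^+ m * _]mulrC divfK //.
Qed.

(* [sum_j t^j / j!^2] is the series of the Bessel function [I_0 (2 sqrt t)]. *)
Definition bessel_sum (J : nat) (t : R) : R := \sum_(j < J) t ^+ j / (j`! ^ 2)%:R.

(** Odd powers average to zero, and the even ones contribute
    ['C(2j, j) / (4^j (2j)!) = 1 / (4^j j!^2)]. All degrees stay below [J.*2], where the mean is
    exact. *)
Lemma mean_exp_sum L J c : (J <= L)%N ->
  mean L (fun x => exp_sum J.*2 (c * cos x)) = bessel_sum J (c ^+ 2 / 4).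
Proof.
move=> JL.
have meanE (K : nat) : mean L (fun x => exp_sum K (c * cos x)) =
    \sum_(m < K) c ^+ m / m`!%:R * mean L (fun x => cos x ^+ m).
  rewrite /mean /exp_sum exchange_big /= mulr_suml; apply: eq_bigr => m _.
  rewrite mulrA mulr_sumr; congr (_ / _).
  by apply: eq_bigr => i _; rewrite exprMn; lra.
rewrite meanE /bessel_sum; elim: J JL => [|J IH] JL; first by rewrite !big_ord0.
rewrite doubleS 2!big_ord_recr [RHS]big_ord_recr /= IH 1?ltnW //.
rewrite !mean_cos_pow; [|lia|lia].
rewrite /= odd_double /= mulr0 addr0 doubleK; congr (_ + _).
have := @bin_fact J.*2 J; rewrite -{1}addnn leq_addr => /(_ isT).
rewrite -{2}addnn addnK => /(congr1 (fun k => k%:R : R)); rewrite !natrM => h.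
have f0 (k : nat) : k`!%:R != 0 :> R by rewrite pnatr_eq0 -lt0n fact_gt0.
rewrite -h exprMn -[J.*2]mul2n !exprM !invfM -exprVn (_ : 2 ^+ 2 = 4 :> R); last lra.
have b0 : 'C(2 * J, J)%:R != 0 :> R by rewrite pnatr_eq0 -lt0n bin_gt0; lia.
have bi : 'C(2 * J, J)%:R * ('C(2 * J, J)%:R)^-1 = 1 :> R by rewrite divff.
set B := 'C(_, _)%:R in bi *.
have -> : (c ^+ 2) ^+ J * (B^-1 * (J`!%:R^-1 / J`!%:R)) * (B * 4^-1 ^+ J) =
  (B * B^-1) * ((c ^+ 2) ^+ J * 4^-1 ^+ J * (J`!%:R^-1 / J`!%:R)) by lra.
by rewrite bi mul1r.
Qed.

Lemma mean_expR L J (c C : R) : (0 < L)%N -> (J <= L)%N -> `|c| <= C ->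
  `|mean L (fun x => expR (c * cos x)) - bessel_sum J (c ^+ 2 / 4)| <= exp_tail J.*2 C.
Proof.
move=> L0 JL cC; rewrite -(mean_exp_sum c JL) /mean -mulrBl -sumrB normrM.
have Lp : 0 < L%:R :> R by rewrite ltr0n.
rewrite [X in _ * X]gtr0_norm ?invr_gt0 // ler_pdivrMr //.
apply: le_trans (ler_norm_sum _ _ _) _.
have -> : exp_tail J.*2 C * L%:R = \sum_(i < L) exp_tail J.*2 C.
  by rewrite sumr_const card_ord mulr_natr.
apply: ler_sum => i _; apply: exp_sum_tail; rewrite normrM.
by apply: le_trans cC; rewrite ler_piMr // cos_max.
Qed.

End Nodes.

(** * Uniform asymptotics *)

Section UniformAsymptotics.
Variable R : realType.

Definition approx (f g : nat -> nat -> nat -> R) : Prop :=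
  forall e : R, 0 < e -> exists N, forall n p q, (N <= n)%N -> (p <= n)%N -> (q <= n)%N ->
    `|f n p q - g n p q| <= e.

Definition bounded3 (f : nat -> nat -> nat -> R) : Prop :=
  exists B : R, 0 <= B /\ forall n p q, (p <= n)%N -> (q <= n)%N -> `|f n p q| <= B.

Lemma approx_refl f : approx f f.
Proof. by move=> e e0; exists 0%N => n p q _ _ _; rewrite subrr normr0 ltW. Qed.

Lemma approx_cvg (u : nat -> R) (c : R) : u @ \oo --> c ->
  approx (fun n _ _ => u n) (fun _ _ _ => c).
Proof.
move=> uc e e0; have /cvgrPdist_le/(_ e e0)[N _ hN] := uc.
by exists N => n p q nN _ _; rewrite distrC; apply: hN.
Qed.

Lemma approxD f f' g g' : approx f f' -> approx g g' ->
  approx (fun n p q => f n p q + g n p q) (fun n p q => f' n p q + g' n p q).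
Proof.
move=> hf hg e e0; have e2 : 0 < e / 2 by lra.
have [N1 h1] := hf _ e2; have [N2 h2] := hg _ e2.
exists (maxn N1 N2) => n p q; rewrite geq_max => /andP[n1 n2] hp hq.
have := h1 n p q n1 hp hq; have := h2 n p q n2 hp hq.
have := ler_normD (f n p q - f' n p q) (g n p q - g' n p q).
rewrite (_ : f n p q - f' n p q + (g n p q - g' n p q) = f n p q + g n p q - (f' n p q + g' n p q));
  last lra.
lra.
Qed.

Lemma approxM f f' g g' : approx f f' -> approx g g' -> bounded3 f' -> bounded3 g' ->
  approx (fun n p q => f n p q * g n p q) (fun n p q => f' n p q * g' n p q).
Proof.
move=> hf hg [B [B0 hB]] [B' [B0' hB']] e e0.
pose d := Num.min 1 (e / (B + B' + 1)).
have BB : 0 < B + B' + 1 by lra.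
have d0 : 0 < d by rewrite lt_min ltr01 divr_gt0.
have d1 : d <= 1 by rewrite ge_min lexx.
have de : d * (B + B' + 1) <= e by rewrite -ler_pdivlMr // ge_min lexx orbT.
have [N1 h1] := hf _ d0; have [N2 h2] := hg _ d0.
exists (maxn N1 N2) => n p q; rewrite geq_max => /andP[n1 n2] hp hq.
have {h1} := h1 n p q n1 hp hq; have {h2} := h2 n p q n2 hp hq.
have {hB} := hB n p q hp hq; have {hB'} := hB' n p q hp hq.
move: (f n p q) (f' n p q) (g n p q) (g' n p q) => x x' y y' hy' hx' hy hx.
have -> : x * y - x' * y' = (x - x') * (y - y') + (x - x') * y' + x' * (y - y') by lra.
apply: le_trans (ler_normD _ _) _.
have t1 : `|(x - x') * (y - y') + (x - x') * y'| <= d + d * B'.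
  apply: le_trans (ler_normD _ _) _; rewrite !normrM; apply: lerD.
    by apply: le_trans (_ : d * 1 <= d); [apply: ler_pM => //; lra|lra].
  by apply: ler_pM.
have t2 : `|x' * (y - y')| <= B * d by rewrite normrM; apply: ler_pM.
lra.
Qed.

Lemma bounded3_cst c : bounded3 (fun _ _ _ => c).
Proof. by exists `|c|. Qed.

Lemma bounded3M f g : bounded3 f -> bounded3 g -> bounded3 (fun n p q => f n p q * g n p q).
Proof.
move=> [B [B0 hB]] [B' [B0' hB']]; exists (B * B'); split; first exact: mulr_ge0.
by move=> n p q hp hq; rewrite normrM ler_pM // ?hB ?hB'.
Qed.

Lemma bounded3D f g : bounded3 f -> bounded3 g -> bounded3 (fun n p q => f n p q + g n p q).
Proof.
move=> [B [B0 hB]] [B' [B0' hB']]; exists (B + B'); split; first exact: addr_ge0.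
by move=> n p q hp hq; rewrite (le_trans (ler_normD _ _)) // lerD ?hB ?hB'.
Qed.

Lemma bounded3X f j : bounded3 f -> bounded3 (fun n p q => f n p q ^+ j).
Proof.
move=> [B [B0 hB]]; exists (B ^+ j); split; first exact: exprn_ge0.
by move=> n p q hp hq; rewrite normrX lerXn2r ?nnegrE ?hB.
Qed.

Lemma approxX f f' j : approx f f' -> bounded3 f' ->
  approx (fun n p q => f n p q ^+ j) (fun n p q => f' n p q ^+ j).
Proof.
move=> hf bf; elim: j => [|j IH]; first exact: approx_refl.
have := approxM hf IH bf (bounded3X j bf).
by rewrite /approx => h e e0; have [N hN] := h e e0; exists N => n p q *;
  rewrite !exprS; exact: hN.
Qed.

Lemma approx_sum (J : nat) (f g : nat -> nat -> nat -> nat -> R) :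
  (forall j, approx (f j) (g j)) ->
  approx (fun n p q => \sum_(j < J) f j n p q) (fun n p q => \sum_(j < J) g j n p q).
Proof.
move=> h; elim: J => [|J IH].
  by move=> e e0; exists 0%N => n p q *; rewrite !big_ord0 subrr normr0 ltW.
have := approxD IH (h J).
by rewrite /approx => h' e e0; have [N hN] := h' e e0; exists N => n p q *;
  rewrite !big_ord_recr; exact: hN.
Qed.

Lemma bounded3_sum (J : nat) (f : nat -> nat -> nat -> nat -> R) :
  (forall j, bounded3 (f j)) -> bounded3 (fun n p q => \sum_(j < J) f j n p q).
Proof.
move=> h; elim: J => [|J IH].
  by exists 0; split=> // n p q _ _; rewrite big_ord0 normr0.
have [B [B0 hB]] := bounded3D IH (h J); exists B; split=> // n p q *.
by rewrite big_ord_recr; exact: hB.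
Qed.

(* The shift by [1 / 2] makes [1 - x - y = 2 * position n p] exact for the
   normalized location [(x, y)]. *)
Definition position (n p : nat) : R := (p%:R + 1 / 2) / n%:R.

Lemma position_ge0 n p : 0 <= position n p.
Proof. by rewrite /position divr_ge0 // addr_ge0. Qed.

Lemma position_le2 n p : (p <= n)%N -> position n p <= 2.
Proof.
case: n => [|n] pn; first by rewrite /position invr0 mulr0.
rewrite /position ler_pdivrMr ?ltr0n //.
have : p%:R <= n.+1%:R :> R by rewrite ler_nat.
have : 1 <= n.+1%:R :> R by rewrite ler1n.
lra.
Qed.

Lemma bounded3_position1 : bounded3 (fun n p _ => position n p).
Proof.
by exists 2; split=> // n p q hp _; rewrite ger0_norm ?position_ge0 // position_le2.
Qed.

Lemma bounded3_position2 : bounded3 (fun n _ q => position n q).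
Proof.
by exists 2; split=> // n p q _ hq; rewrite ger0_norm ?position_ge0 // position_le2.
Qed.

Lemma cvg_inv_nat (c : R) : (fun n : nat => c / n%:R) @ \oo --> (0 : R).
Proof.
rewrite -[X in _ --> X](mulr0 c); apply: cvgMr.
have := @cvg_harmonic R; rewrite -(cvg_shiftS (fun n : nat => (n%:R : R)^-1)).
by [].
Qed.

Lemma approx_ratio j : approx (fun n p _ => (p - j)%N%:R / n%:R) (fun n p _ => position n p).
Proof.
(* The numerators differ by at most [j] from the truncated subtraction and [1 / 2] from the
   shift. *)
move=> e e0; have [N hN] := approx_cvg (cvg_inv_nat (j%:R + 1)) e0.
exists (maxn N 1) => n p q; rewrite geq_max => /andP[nN n1] hp hq.
have := hN n p q nN hp hq; rewrite subr0; apply: le_trans.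
have ni : 0 <= n%:R^-1 :> R by rewrite invr_ge0 ler0n.
rewrite /position -mulrBl !normrM ler_wpM2r // [X in _ <= X]ger0_norm ?addr_ge0 // ler_norml.
have h1 : (p - j)%N%:R <= p%:R :> R by rewrite ler_nat leq_subr.
have h2 : p%:R <= (p - j)%N%:R + j%:R :> R by rewrite -natrD ler_nat; lia.
apply/andP; split; lra.
Qed.

Lemma approx_bin1 j : approx (fun n p _ => 'C(p, j)%:R / n%:R ^+ j)
  (fun n p _ => position n p ^+ j / j`!%:R).
Proof.
have h : approx (fun n p _ => (p ^_ j)%:R / n%:R ^+ j) (fun n p _ => position n p ^+ j).
  elim: j => [|j IH].
    move=> e e0; exists 0%N => n p q _ _ _.
    by rewrite ffactn0 !expr0 divr1 subrr normr0 ltW.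
  have := approxM IH (approx_ratio j) (bounded3X j bounded3_position1) bounded3_position1.
  move=> h e e0; have [N hN] := h e e0; exists N => n p q nN hp hq.
  have := hN n p q nN hp hq; rewrite ffactnSr natrM !exprSr invfM.
  by rewrite mulrACA.
have := approxM h (@approx_refl (fun _ _ _ => (j`!%:R)^-1))
  (bounded3X j bounded3_position1) (bounded3_cst _).
move=> h' e e0; have [N hN] := h' e e0; exists N => n p q nN hp hq.
have := hN n p q nN hp hq; rewrite -(bin_ffact p j) natrM.
have fi : j`!%:R * (j`!%:R)^-1 = 1 :> R by rewrite divff // pnatr_eq0 -lt0n fact_gt0.
have -> // : 'C(p, j)%:R * j`!%:R / n%:R ^+ j / j`!%:R = 'C(p, j)%:R / n%:R ^+ j :> R.
have -> : 'C(p, j)%:R * j`!%:R / n%:R ^+ j / j`!%:R =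
  'C(p, j)%:R / n%:R ^+ j * (j`!%:R / j`!%:R) :> R by lra.
by rewrite fi mulr1.
Qed.

Lemma approx_bin2 j : approx (fun n _ q => 'C(q, j)%:R / n%:R ^+ j)
  (fun n _ q => position n q ^+ j / j`!%:R).
Proof.
move=> e e0; have [N hN] := approx_bin1 j e0; exists N => n p q nN hp hq.
exact: (hN n q p).
Qed.

Definition decay (k n : nat) : R := expR (- (k%:R / n%:R)).

Lemma decay_gt0 k n : 0 < decay k n. Proof. exact: expR_gt0. Qed.

Lemma decay_le1 k n : decay k n <= 1.
Proof. by rewrite expR_le1 oppr_le0 divr_ge0. Qed.

Lemma cvg_decay k : decay k @ \oo --> (1 : R).
Proof.
rewrite -[X in _ --> X](expR0 R) -oppr0.
apply: (cvg_comp (fun n : nat => - (k%:R / n%:R : R)) expR); last exact: continuous_expR.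
by apply: cvgN; exact: cvg_inv_nat.
Qed.

Lemma one_decay_le k n : 0 <= 1 - decay k n <= k%:R / n%:R.
Proof.
rewrite subr_ge0 decay_le1 /= /decay.
have := expR_ge1Dx (- (k%:R / n%:R) : R); lra.
Qed.

Lemma cvg_one_decay k : (fun n : nat => n%:R * (1 - decay k n)) @ \oo --> (k%:R : R).
Proof.
have lo : (fun n : nat => k%:R / (1 + k%:R / n%:R) : R) @ \oo --> (k%:R : R).
  rewrite -[X in _ --> X]divr1 -[X in _ / X](addr0 1).
  apply: cvgMr; apply: cvgV; first by rewrite addr0.
  by apply: cvgD; [exact: cvg_cst | exact: cvg_inv_nat].
have hi : (fun _ : nat => k%:R : R) @ \oo --> (k%:R : R) by exact: cvg_cst.
apply: (squeeze_cvgr _ lo hi).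
exists 1%N => // n /= n1; have n0 : 0 < n%:R :> R by rewrite ltr0n.
have /andP[_ up] := one_decay_le k n.
apply/andP; split; last by rewrite mulrC -ler_pdivlMr.
have x0 : 0 <= k%:R / n%:R :> R by rewrite divr_ge0.
have e1 : decay k n <= (1 + k%:R / n%:R)^-1.
  have x1 : 0 < 1 + k%:R / n%:R :> R by lra.
  by rewrite /decay expRN lef_pV2 ?posrE ?expR_gt0 // expR_ge1Dx.
set x := k%:R / n%:R in x0 e1 *.
have xi : (1 + x) * (1 + x)^-1 = 1 by rewrite divff // gt_eqF //; lra.
have -> : k%:R = n%:R * x by rewrite mulrC divfK // gt_eqF.
rewrite -mulrA ler_pM2l //; lra.
Qed.

End UniformAsymptotics.

(** * The limit of the transform *)

Section Transform.
Variable R : realType.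

Lemma bernoulli_ineq (x : R) m : 0 <= x -> x <= 1 -> 1 - m%:R * x <= (1 - x) ^+ m.
Proof.
move=> x0 x1; elim: m => [|m IH]; first by rewrite mul0r subr0 expr0.
have h : (1 - x) * (1 - m%:R * x) <= (1 - x) ^+ m.+1.
  by rewrite exprS ler_wpM2l // subr_ge0.
apply: le_trans h; rewrite -natr1.
have : 0 <= m%:R * (x * x) by rewrite !mulr_ge0.
lra.
Qed.

Lemma ffact_le_exp j (p n : nat) : (p <= n)%N -> (p ^_ j <= n ^ j)%N.
Proof.
move=> h; elim: j => [//|j IH]; rewrite ffactnSr expnSr leq_mul //.
exact: leq_trans (leq_subr _ _) h.
Qed.

Definition prefactor (z : R) (p q : nat) : R := 1 / (2 - z) * (z / (2 - z)) ^+ (p + q).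

Lemma prefactor_itv z p q : 0 <= z -> z <= 1 -> 0 <= prefactor z p q <= 1.
Proof.
move=> z0 z1; have h : 0 <= z / (2 - z) <= 1.
  by rewrite divr_ge0 ?ler_pdivrMr //=; lra.
have h' : 0 <= 1 / (2 - z) <= 1 by rewrite divr_ge0 ?ler_pdivrMr //=; lra.
move/andP: h => [a b]; move/andP: h' => [a' b'].
rewrite /prefactor mulr_ge0 ?exprn_ge0 //=.
by rewrite mulr_ile1 ?exprn_ge0 // exprn_ile1.
Qed.

(** Since [z * (2 - z) = 1 - (1 - z) ^+ 2], the base [z / (2 - z)] is [z ^+ 2] up to the factor
    [1 - d] with [d = (1 - z) ^+ 2] of order [1 / n ^ 2]. Even to the power [p + q <= 2 * n] this
    factor tends to 1, by the Bernoulli inequality. *)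
Lemma approx_prefactor k : approx (fun n p q => prefactor (decay R k n) p q)
  (fun n p q => expR (- (2 * k%:R * (position R n p + position R n q)))).
Proof.
have cc : (fun n : nat => expR ((2 * k%:R) / n%:R) / (2 - decay R k n)) @ \oo --> (1 : R).
  rewrite -[X in _ --> X]divr1.
  have -> : (1 : R) / 1 = expR 0 / (2 - 1) by rewrite expR0; congr (_ / _); lra.
  apply: cvgM.
    apply: (cvg_comp (fun n : nat => ((2 * k%:R) / n%:R : R)) expR); last exact: continuous_expR.
    exact: cvg_inv_nat.
  apply: cvgV; first by rewrite gt_eqF //; lra.
  by apply: cvgB; [exact: cvg_cst | exact: cvg_decay].
move=> e e0; have e2 : 0 < e / 2 by lra.
have [N1 h1] := approx_cvg cc e2.
have [N2 h2] := approx_cvg (@cvg_inv_nat R (2 * k%:R ^+ 2)) e2.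
exists (maxn (maxn N1 N2) 1) => n p q; rewrite !geq_max => /andP[/andP[n1 n2] n0] hp hq.
have {h1} := h1 n 0%N 0%N n1 (leq0n _) (leq0n _).
have {h2} := h2 n 0%N 0%N n2 (leq0n _) (leq0n _).
set cn := expR _ / _; set z := decay R k n; set E := expR _.
have nR : 0 < n%:R :> R by rewrite ltr0n.
have z0 : 0 < z by exact: decay_gt0.
have z1 : z <= 1 by exact: decay_le1.
have /andP[A0 A1] := prefactor_itv p q (ltW z0) z1.
set A := prefactor z p q in A0 A1 *.
pose d := (1 - z) ^+ 2.
have d0 : 0 <= d by exact: sqr_ge0.
have d1 : d <= 1 by rewrite /d expr_le1 //; lra.
have zi : (2 - z) * (2 - z)^-1 = 1 by rewrite divff // gt_eqF; lra.
(* An exact identity: the two half shifts in the positions account for the factor [expR (2 * k / n)]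
   inside [cn]. *)
have key : A * (1 - d) ^+ (p + q) = E * cn.
  rewrite /A /prefactor -[1 / (2 - z) * _ * _]mulrA -exprMn.
  have -> : z / (2 - z) * (1 - d) = z ^+ 2.
    have -> : z / (2 - z) * (1 - d) = z ^+ 2 * ((2 - z) * (2 - z)^-1) by rewrite /d; lra.
    by rewrite zi mulr1.
  have -> : E * cn = (E * expR ((2 * k%:R) / n%:R)) * (1 / (2 - z)) by rewrite /cn -/z; lra.
  rewrite mulrC; congr (_ * _).
  rewrite -exprM /z /decay -expRM_natl /E -expRD; congr expR.
  rewrite natrM natrD /position; lra.
have dn : (p + q)%:R * d <= 2 * k%:R ^+ 2 / n%:R.
  have dk : d <= (k%:R / n%:R) ^+ 2.
    have /andP[a b] := one_decay_le R k n.
    by rewrite /d lerXn2r // nnegrE divr_ge0.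
  have pq : (p + q)%:R <= 2 * n%:R :> R by rewrite -natrM ler_nat mul2n -addnn leq_add.
  apply: le_trans (_ : (2 * n%:R) * (k%:R / n%:R) ^+ 2 <= _).
    by apply: ler_pM.
  rewrite exprMn expr2 (_ : 2 * n%:R * _ = 2 * (k%:R * k%:R * n%:R^-1) * (n%:R / n%:R)); last lra.
  by rewrite divff ?gt_eqF // mulr1; lra.
have bern := bernoulli_ineq (p + q) d0 d1.
have B1 : (1 - d) ^+ (p + q) <= 1 by apply: exprn_ile1; lra.
set B := (1 - d) ^+ _ in key bern B1.
have E0 : 0 < E by exact: expR_gt0.
have E1 : E <= 1.
  by rewrite expR_le1 oppr_le0 mulr_ge0 ?addr_ge0 ?position_ge0.
rewrite subr0 ger0_norm ?divr_ge0 ?mulr_ge0 ?exprn_ge0 // => hd hc.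
have -> : A - E = A * (1 - B) + E * (cn - 1) by rewrite mulrBr key; lra.
clearbody A E B cn.
apply: le_trans (ler_normD _ _) _; rewrite !normrM.
have t1 : `|A| * `|1 - B| <= 1 * (e / 2).
  by apply: ler_pM => //; rewrite ger0_norm //; lra.
have t2 : `|E| * `|cn - 1| <= 1 * (e / 2).
  by apply: ler_pM => //; rewrite ger0_norm // ltW.
by apply: le_trans (lerD t1 t2) _; rewrite !mul1r -splitr.
Qed.

Definition hyp_arg (k n : nat) : R := 2 * (1 - decay R k n) ^+ 2 / decay R k n.

Lemma hyp_arg_ge0 k n : 0 <= hyp_arg k n.
Proof. by rewrite /hyp_arg divr_ge0 ?(ltW (decay_gt0 R k n)) // mulr_ge0 ?sqr_ge0. Qed.

Lemma cvg_hyp_arg k : (fun n => n%:R ^+ 2 * hyp_arg k n) @ \oo --> (2 * k%:R ^+ 2 : R).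
Proof.
have -> : (fun n => n%:R ^+ 2 * hyp_arg k n) =
   (fun n => 2 * (n%:R * (1 - decay R k n)) ^+ 2 / decay R k n).
  by apply/funext => n; rewrite /hyp_arg exprMn; lra.
rewrite -[X in _ --> X]divr1; apply: cvgM.
  apply: cvgMr; rewrite expr2; under eq_fun do rewrite expr2.
  by apply: cvgM; exact: cvg_one_decay.
by apply: cvgV; [exact: oner_neq0 | exact: cvg_decay].
Qed.

Lemma approx_hyp_head k J :
  approx (fun n p q => \sum_(j < J) 'C(p, j)%:R * 'C(q, j)%:R * hyp_arg k n ^+ j)
    (fun n p q => bessel_sum J (2 * k%:R ^+ 2 * (position R n p * position R n q))).
Proof.
have h j : approx (fun n p q => ('C(p, j)%:R / n%:R ^+ j * ('C(q, j)%:R / n%:R ^+ j)) *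
      (n%:R ^+ 2 * hyp_arg k n) ^+ j)
    (fun n p q => (position R n p ^+ j / j`!%:R * (position R n q ^+ j / j`!%:R)) *
      (2 * k%:R ^+ 2) ^+ j).
  have b1 : bounded3 (fun n p _ => position R n p ^+ j / j`!%:R).
    by apply: bounded3M (bounded3_cst _); exact: bounded3X (bounded3_position1 R).
  have b2 : bounded3 (fun n _ q => position R n q ^+ j / j`!%:R).
    by apply: bounded3M (bounded3_cst _); exact: bounded3X (bounded3_position2 R).
  apply: approxM.
  - exact: (approxM (@approx_bin1 R j) (@approx_bin2 R j) b1 b2).
  - exact: (@approxX R (fun n _ _ => n%:R ^+ 2 * hyp_arg k n) (fun _ _ _ => 2 * k%:R ^+ 2) j
      (approx_cvg (@cvg_hyp_arg k)) (bounded3_cst _)).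
  - exact: bounded3M b1 b2.
  - exact: (@bounded3X R (fun _ _ _ => 2 * k%:R ^+ 2) j (bounded3_cst _)).
move=> e e0; have [N hN] := approx_sum J h e0.
exists (maxn N 1) => n p q; rewrite geq_max => /andP[nN n1] hp hq.
have := hN n p q nN hp hq.
have n0 : n%:R != 0 :> R by rewrite pnatr_eq0 -lt0n.
have -> : \sum_(j < J) 'C(p, j)%:R / n%:R ^+ j * ('C(q, j)%:R / n%:R ^+ j) *
    (n%:R ^+ 2 * hyp_arg k n) ^+ j = \sum_(j < J) 'C(p, j)%:R * 'C(q, j)%:R * hyp_arg k n ^+ j.
  apply: eq_bigr => j _; rewrite exprMn -exprM mulnC exprM.
  have ni : n%:R ^+ j / n%:R ^+ j = 1 :> R by rewrite divff // expf_neq0.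
  set X := n%:R ^+ j in ni *.
  have -> : 'C(p, j)%:R / X * ('C(q, j)%:R / X) * (X ^+ 2 * hyp_arg k n ^+ j) =
    'C(p, j)%:R * 'C(q, j)%:R * hyp_arg k n ^+ j * (X / X) * (X / X) by lra.
  by rewrite ni !mulr1.
have -> // : \sum_(j < J) position R n p ^+ j / j`!%:R * (position R n q ^+ j / j`!%:R) *
    (2 * k%:R ^+ 2) ^+ j = bessel_sum J (2 * k%:R ^+ 2 * (position R n p * position R n q)).
apply: eq_bigr => j _; rewrite !exprMn natrX expr2 invfM; lra.
Qed.

(** Each term is at most [C ^+ j / j!]: one factorial is kept from the binomials, and the powers of
    [n] are absorbed into [n ^ 2 * hyp_arg k n <= C]. *)
Lemma hyp_tail k n p q J C : (0 < n)%N -> (p <= n)%N -> (q <= n)%N ->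
  n%:R ^+ 2 * hyp_arg k n <= C ->
  `|hyp p q (hyp_arg k n) - \sum_(j < J) 'C(p, j)%:R * 'C(q, j)%:R * hyp_arg k n ^+ j|
    <= exp_tail J C.
Proof.
move=> n0 hp hq hC; set u := hyp_arg k n in hC *.
have u0 : 0 <= u by exact: hyp_arg_ge0.
clearbody u.
have C0 : 0 <= C by apply: le_trans hC; rewrite mulr_ge0 ?sqr_ge0.
rewrite (@hypE _ (maxn p.+1 J)) ?leq_maxl //.
set f := fun j => 'C(p, j)%:R * 'C(q, j)%:R * u ^+ j.
rewrite -!(big_mkord predT f) (big_cat_nat (n := J)) ?leq_maxr //= addrAC subrr add0r.
have fle j : 0 <= f j <= C ^+ j / j`!%:R.
  apply/andP; split; first by rewrite /f !mulr_ge0 ?exprn_ge0.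
  have fj : 0 < j`!%:R :> R by rewrite ltr0n fact_gt0.
  have b1 : 'C(p, j)%:R <= n%:R ^+ j / j`!%:R :> R.
    by rewrite ler_pdivlMr // -natrM bin_ffact -natrX ler_nat ffact_le_exp.
  have b2 : 'C(q, j)%:R <= n%:R ^+ j :> R.
    rewrite -natrX ler_nat; apply: leq_trans (ffact_le_exp j hq).
    by rewrite -bin_ffact leq_pmulr ?fact_gt0.
  apply: le_trans (_ : n%:R ^+ j / j`!%:R * n%:R ^+ j * u ^+ j <= _).
    by rewrite /f ler_wpM2r ?exprn_ge0 // ler_pM.
  have -> : n%:R ^+ j / j`!%:R * n%:R ^+ j * u ^+ j = (n%:R ^+ 2 * u) ^+ j / j`!%:R.
    by rewrite exprMn -exprM mulnC exprM expr2; lra.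
  apply: ler_wpM2r; first by rewrite invr_ge0 ltW.
  by rewrite lerXn2r ?nnegrE // mulr_ge0 ?sqr_ge0.
rewrite ger0_norm; last by apply: sumr_ge0 => j _; have /andP[] := fle j.
apply: le_trans (_ : exp_sum (maxn p.+1 J) C - exp_sum J C <= _); last first.
  by rewrite /exp_tail lerD2r exp_sum_le.
rewrite /exp_sum -!(big_mkord predT (fun j => C ^+ j / j`!%:R)).
rewrite [X in _ <= X - _](big_cat_nat (n := J)) ?leq_maxr //= addrAC subrr add0r.
by apply: ler_sum => j _; have /andP[] := fle j.
Qed.

Definition xi (P Q x : R) : R := 2 * (P + Q) + 2 * Num.sqrt (2 * (P * Q)) * cos x.

(** The series is truncated at a length [J] that depends only on [k] and [e], and any [L >= J] with
    [L > 0] will do. Hence the number of nodes can be fixed before [n] grows. The Bessel argument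
    [2 k^2 P Q] equals [c^2 / 4] for the coefficient [c] of the cosine in [- k * xi]. *)
Lemma rho_gen_mean k (e : R) : 0 < e -> exists L0, forall L, (L0 <= L)%N -> exists N,
  forall n p q, (N <= n)%N -> (p <= n)%N -> (q <= n)%N ->
  `|rho_gen (decay R k n) p q -
    mean L (fun x => expR (- (k%:R * xi (position R n p) (position R n q) x)))| <= e.
Proof.
move=> e0; have e3 : 0 < e / 3 by lra.
have [J1 hJ1] : exists J, forall i, (J <= i)%N -> exp_tail i (2 * k%:R ^+ 2 + 1 : R) <= e / 3.
  have /cvgrPdist_le/(_ _ e3)[J _ hJ] := @exp_tail_cvg R (2 * k%:R ^+ 2 + 1).
  exists J => i /hJ /=; rewrite sub0r normrN; apply: le_trans; exact: ler_norm.
have [J2 hJ2] : exists J, forall i, (J <= i)%N -> exp_tail i (6 * k%:R : R) <= e / 3.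
  have /cvgrPdist_le/(_ _ e3)[J _ hJ] := @exp_tail_cvg R (6 * k%:R).
  exists J => i /hJ /=; rewrite sub0r normrN; apply: le_trans; exact: ler_norm.
pose J := maxn J1 J2; exists (maxn J 1) => L; rewrite geq_max => /andP[JL L1].
pose T n p q := 2 * k%:R ^+ 2 * (position R n p * position R n q).
have bexp : bounded3 (fun n p q => expR (- (2 * k%:R * (position R n p + position R n q)))).
  exists 1; split=> // n p q _ _; rewrite ger0_norm ?expR_ge0 // expR_le1 oppr_le0.
  by rewrite mulr_ge0 ?addr_ge0 ?position_ge0.
have bbes : bounded3 (fun n p q => bessel_sum J (T n p q)).
  apply: (@bounded3_sum _ J (fun j n p q => T n p q ^+ j / (j`! ^ 2)%:R)) => j.
  apply: bounded3M (bounded3_cst _); apply: bounded3X; apply: bounded3M (bounded3_cst _) _.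
  exact: bounded3M (bounded3_position1 R) (bounded3_position2 R).
have [N1 h1] := approxM (approx_prefactor k) (approx_hyp_head k J) bexp bbes e3.
have [N2 h2] : exists N, forall n, (N <= n)%N -> n%:R ^+ 2 * hyp_arg k n <= 2 * k%:R ^+ 2 + 1.
  have /cvgrPdist_le/(_ _ ltr01)[N _ hN] := @cvg_hyp_arg k.
  exists N => n /hN /=; rewrite ler_norml => /andP[]; lra.
exists (maxn (maxn N1 N2) 1) => n p q; rewrite !geq_max => /andP[/andP[n1 n2] n0] hp hq.
have {h1} := h1 n p q n1 hp hq; have {}h2 := h2 n n2.
have t1 := hyp_tail J n0 hp hq h2; have := hJ1 J (leq_maxl _ _) => t2.
pose P := position R n p; pose Q := position R n q.
have P0 : 0 <= P by exact: position_ge0.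
have Q0 : 0 <= Q by exact: position_ge0.
have P2 : P <= 2 by exact: position_le2.
have Q2 : Q <= 2 by exact: position_le2.
pose c := - (k%:R * (2 * Num.sqrt (2 * (P * Q)))).
have s2 : Num.sqrt (2 * (P * Q)) ^+ 2 = 2 * (P * Q) by rewrite sqr_sqrtr // !mulr_ge0.
have c4 : c ^+ 2 / 4 = T n p q.
  rewrite /c sqrrN !exprMn s2 /T -/P -/Q; lra.
(* Positions are at most 2, so the square root is at most [sqrt 8 < 3]. *)
have cC : `|c| <= 6 * k%:R.
  rewrite normrN ger0_norm; last by rewrite !mulr_ge0 ?sqrtr_ge0.
  have : Num.sqrt (2 * (P * Q)) <= 3.
    rewrite -(@ler_pXn2r _ 2) ?nnegrE ?sqrtr_ge0 // s2.
    have : P * Q <= 2 * 2 by apply: ler_pM.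
    lra.
  move=> h3; rewrite mulrC ler_wpM2r //; lra.
have t3 := mean_expR L1 JL cC; rewrite c4 in t3.
have t4 : exp_tail J.*2 (6 * k%:R) <= e / 3.
  by apply: hJ2; apply: leq_trans (leq_maxr J1 J2) _; rewrite -/J -addnn leq_addr.
have -> : mean L (fun x => expR (- (k%:R * xi P Q x))) =
    expR (- (2 * k%:R * (P + Q))) * mean L (fun x => expR (c * cos x)).
  rewrite /mean mulrA mulr_sumr; congr (_ / _); apply: eq_bigr => i _.
  rewrite -expRD; congr expR; rewrite /xi /c; lra.
rewrite -/P -/Q /rho_gen -/(prefactor _ _ _) -/(hyp_arg k n).
have /andP[A0 A1] := prefactor_itv p q (ltW (decay_gt0 R k n)) (decay_le1 R k n).
have E0 := expR_ge0 (- (2 * k%:R * (P + Q))).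
have E1 : expR (- (2 * k%:R * (P + Q))) <= 1.
  by rewrite expR_le1 oppr_le0 mulr_ge0 ?addr_ge0.
move: t1 t3; rewrite -/(T n p q).
set A := prefactor _ p q in A0 A1 *; set E := expR _ in E0 E1 *.
set H := hyp p q _; set HJ := \sum_(j < J) _; set S := bessel_sum J _; set M := mean _ _.
move=> t1 t3 t5.
have -> : A * H - E * M = A * (H - HJ) + (A * HJ - E * S) + (- E) * (M - S) by lra.
have u1 : `|A * (H - HJ)| <= 1 * (e / 3).
  by rewrite normrM; apply: ler_pM => //; [rewrite ger0_norm | exact: le_trans t1 t2].
have u2 : `|(- E) * (M - S)| <= 1 * (e / 3).
  by rewrite normrM normrN; apply: ler_pM => //; [rewrite ger0_norm | exact: le_trans t3 t4].
have := ler_normD (A * (H - HJ) + (A * HJ - E * S)) ((- E) * (M - S)).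
have := ler_normD (A * (H - HJ)) (A * HJ - E * S).
lra.
Qed.

End Transform.

(** * From transforms to distribution functions *)

Section StepFunction.
Variable R : realType.

(* [1 - (1 - v^m)^N] with [N a^m] small and [N b^m] large. *)
Lemma step_poly (a b e : R) : 0 <= a -> a < b -> b <= 1 -> 0 < e ->
  exists B : {poly R}, forall v, 0 <= v -> v <= 1 ->
    [/\ 0 <= B.[v], B.[v] <= 1, v <= a -> B.[v] <= e & b <= v -> 1 - e <= B.[v]].
Proof.
move=> a0 ab b1 e0; have b0 : 0 < b by apply: le_lt_trans ab.
have r1 : `|a / b| < 1 by rewrite ger0_norm ?divr_ge0 ?(ltW b0) // ltr_pdivrMr // mul1r.
(* With [N] about [1 / (e b^m)], the first bound makes [a^m / (e b^m)] at most [e / 2]; the second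
   pays for rounding [N] up. *)
pose t := Num.min (e ^+ 2 / 2) (e / 2).
have t0 : 0 < t by rewrite lt_min !divr_gt0 ?exprn_gt0.
have [m hm] : exists m, (a / b) ^+ m <= t.
  have /cvgrPdist_le/(_ _ t0)[m _ hm] := cvg_expr r1.
  exists m; have := hm m (leqnn m); rewrite /= sub0r normrN; exact: le_trans (ler_norm _).
have te : t <= e / 2 by rewrite ge_min lexx orbT.
have te2 : t <= e ^+ 2 / 2 by rewrite ge_min lexx.
have am : a ^+ m <= t.
  apply: le_trans hm; apply: lerXn2r; rewrite ?nnegrE ?divr_ge0 ?(ltW b0) //.
  by rewrite ler_pdivlMr // ler_piMr.
have bm0 : 0 < b ^+ m by rewrite exprn_gt0.
pose y := (e * b ^+ m)^-1.
have y0 : 0 < y by rewrite invr_gt0 mulr_gt0.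
have [N [N1 N2]] : exists N : nat, y <= N%:R /\ N%:R <= y + 1.
  have /andP[h1 h2] := truncn_itv (ltW y0).
  exists (Num.truncn y).+1; split; first exact: ltW.
  by rewrite -natr1 lerD2r.
have Na : N%:R * a ^+ m <= e.
  apply: le_trans (_ : (y + 1) * a ^+ m <= _); first by rewrite ler_wpM2r ?exprn_ge0.
  rewrite mulrDl mul1r; have ya : y * a ^+ m <= e / 2.
    have -> : y * a ^+ m = (a / b) ^+ m / e by rewrite /y expr_div_n invfM; lra.
    by rewrite ler_pdivrMr //; apply: le_trans hm _; apply: le_trans te2 _; rewrite expr2; lra.
  lra.
have Nb : 1 <= e * (N%:R * b ^+ m).
  rewrite mulrCA; apply: le_trans (_ : y * (e * b ^+ m) <= _).
    by rewrite /y mulVf // gt_eqF // mulr_gt0.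
  by rewrite ler_wpM2r // mulr_ge0 ?(ltW e0) ?(ltW bm0).
exists (1 - (1 - 'X^m) ^+ N) => v v0 v1.
have -> : (1 - (1 - 'X^m) ^+ N).[v] = 1 - (1 - v ^+ m) ^+ N :> R by rewrite !hornerE.
have vm0 : 0 <= v ^+ m by rewrite exprn_ge0.
have vm1 : v ^+ m <= 1 by rewrite exprn_ile1.
have p0 : 0 <= (1 - v ^+ m) ^+ N by rewrite exprn_ge0 ?subr_ge0.
have p1 : (1 - v ^+ m) ^+ N <= 1 by rewrite exprn_ile1 // ?subr_ge0 // gerBl.
split; [lra|lra| |] => hv.
  have := bernoulli_ineq N vm0 vm1.
  have : N%:R * v ^+ m <= N%:R * a ^+ m by rewrite ler_wpM2l // lerXn2r ?nnegrE.
  lra.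
have bern : 1 + N%:R * v ^+ m <= (1 + v ^+ m) ^+ N.
  elim: (N) => [|k IH]; first by rewrite mul0r addr0 expr0.
  have h : (1 + v ^+ m) * (1 + k%:R * v ^+ m) <= (1 + v ^+ m) ^+ k.+1.
    by rewrite exprS ler_wpM2l //; lra.
  apply: le_trans h; rewrite -natr1.
  have : 0 <= k%:R * (v ^+ m * v ^+ m) by rewrite !mulr_ge0.
  lra.
(* With [bern] this bounds [(1 - v^m)^N] by [1 / (1 + N v^m)]. *)
have prod1 : (1 - v ^+ m) ^+ N * (1 + v ^+ m) ^+ N <= 1.
  rewrite -exprMn exprn_ile1 //; first by rewrite mulr_ge0 ?subr_ge0 ?addr_ge0.
  have : 0 <= v ^+ m * v ^+ m by rewrite mulr_ge0.
  lra.
suff : (1 - v ^+ m) ^+ N <= e by lra.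
have big : 1 <= e * (1 + v ^+ m) ^+ N.
  apply: le_trans Nb _; rewrite ler_wpM2l ?(ltW e0) //; apply: le_trans bern.
  have : N%:R * b ^+ m <= N%:R * v ^+ m by rewrite ler_wpM2l // lerXn2r ?nnegrE ?(ltW b0).
  lra.
have q0 : 0 < (1 + v ^+ m) ^+ N by rewrite exprn_gt0 //; lra.
by rewrite -(ler_pM2r q0); apply: le_trans prod1 big.
Qed.

Definition cdf (p q n : nat) : R := \sum_(M < n) rho R p q M.

(** The expectation of [B] at [exp (- M / n)] when [M] has law [rho p q], written with the closed
    form of the transform. *)
Definition expectation (B : {poly R}) (n p q : nat) : R :=
  \sum_(k < size B) B`_k * rho_gen (decay R k n) p q.

Definition decay_var (n M : nat) : R := expR (- (M%:R / n%:R)).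

Lemma rho_gen1 p q : rho_gen (1 : R) p q = 1.
Proof.
rewrite /rho_gen (_ : 2 - 1 = 1 :> R); last lra.
rewrite !divr1 expr1n !mul1r subrr expr2 !mulr0 /hyp big_ord_recl !bin0 expr0 !mulr1.
by rewrite big1 ?addr0 // => i _; rewrite exprS mul0r mulr0.
Qed.

Lemma rho_mass_le1 p q K : \sum_(M < K) rho R p q M <= 1.
Proof.
have h := @rho_sum_cvg R 1 p q ltr01 (lexx 1).
rewrite rho_gen1 in h.
have -> : \sum_(M < K) rho R p q M = rho_sum 1 p q K.
  by apply: eq_bigr => M _; rewrite expr1n mulr1.
rewrite -[leRHS](cvg_lim (@Rhausdorff R) h); apply: nondecreasing_cvgn_le.
  exact: rho_sum_homo.
by apply/cvg_ex; exists 1.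
Qed.

Lemma expectation_cvg B n p q :
  (fun K => \sum_(M < K) rho R p q M * B.[decay_var n M]) @ \oo --> expectation B n p q.
Proof.
have -> : (fun K => \sum_(M < K) rho R p q M * B.[decay_var n M]) =
    (fun K => \sum_(k < size B) B`_k * rho_sum (decay R k n) p q K).
  apply/funext => K; rewrite /rho_sum; under [RHS]eq_bigr => k _ do rewrite mulr_sumr.
  rewrite exchange_big /=; apply: eq_bigr => M _; rewrite horner_coef mulr_sumr.
  apply: eq_bigr => k _.
  have -> : decay_var n M ^+ k = decay R k n ^+ M.
    rewrite /decay_var /decay -!expRM_natl; congr expR; lra.
  lra.
rewrite /expectation; elim: (size B) => [|m IH].
  by rewrite big_ord0; under eq_fun do rewrite big_ord0; exact: cvg_cst.
rewrite big_ord_recr; under eq_fun do rewrite big_ord_recr; apply: cvgD => //.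
by apply: cvgMr; apply: rho_sum_cvg; [exact: decay_gt0 | exact: decay_le1].
Qed.

(** [B + e] dominates the indicator of [M < n], and the total mass is at most 1. *)
Lemma cdf_le B n p q e : 0 <= e -> (forall M, 0 <= B.[decay_var n M]) ->
  (forall M, (M < n)%N -> 1 - e <= B.[decay_var n M]) ->
  cdf p q n <= expectation B n p q + e.
Proof.
move=> e0 B0 B1; have h := @expectation_cvg B n p q.
have : cdf p q n - e <= expectation B n p q; last by lra.
rewrite -(cvg_lim (@Rhausdorff R) h); apply: limr_ge; first by apply/cvg_ex; eexists; exact: h.
near=> K; have nK : (n <= K)%N by near: K; exact: nbhs_infty_ge.
rewrite -(big_mkord predT (fun M => rho R p q M * B.[decay_var n M])) (big_cat_nat (n := n)) //=.
have t1 : 0 <= \sum_(n <= M < K) rho R p q M * B.[decay_var n M].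
  by apply: sumr_ge0 => M _; rewrite mulr_ge0 ?rho_ge0.
have t2 : cdf p q n * (1 - e) <= \sum_(0 <= M < n) rho R p q M * B.[decay_var n M].
  rewrite big_mkord /cdf mulr_suml; apply: ler_sum => M _.
  by rewrite ler_wpM2l ?rho_ge0 // B1.
have t3 : cdf p q n * e <= 1 * e by rewrite ler_wpM2r // rho_mass_le1.
lra.
Unshelve. all: by end_near. Qed.

Lemma cdf_ge B n p q e : 0 <= e -> (forall M, B.[decay_var n M] <= 1) ->
  (forall M, (n <= M)%N -> B.[decay_var n M] <= e) ->
  expectation B n p q - e <= cdf p q n.
Proof.
move=> e0 B0 B1; have h := @expectation_cvg B n p q.
have : expectation B n p q <= cdf p q n + e; last by lra.
rewrite -(cvg_lim (@Rhausdorff R) h); apply: limr_le; first by apply/cvg_ex; eexists; exact: h.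
near=> K; have nK : (n <= K)%N by near: K; exact: nbhs_infty_ge.
have mass : \sum_(n <= M < K) rho R p q M <= 1.
  apply: le_trans (@rho_mass_le1 p q K).
  rewrite -(big_mkord predT (fun M => rho R p q M)) [leRHS](big_cat_nat (n := n)) //= lerDr.
  by apply: sumr_ge0 => M _; exact: rho_ge0.
rewrite -(big_mkord predT (fun M => rho R p q M * B.[decay_var n M])) (big_cat_nat (n := n)) //=.
apply: lerD.
  rewrite big_mkord; apply: ler_sum => M _.
  by rewrite -[leRHS]mulr1 ler_wpM2l ?rho_ge0.
apply: le_trans (_ : (\sum_(n <= M < K) rho R p q M) * e <= _).
  rewrite mulr_suml big_nat_cond [leRHS]big_nat_cond; apply: ler_sum => M /andP[/andP[hM _] _].
  by rewrite ler_wpM2l ?rho_ge0 // B1.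
by rewrite -[leRHS]mul1r ler_wpM2r.
Unshelve. all: by end_near. Qed.

Lemma expectation_mean (B : {poly R}) e : 0 < e -> exists L0, forall L, (L0 <= L)%N ->
  exists N, forall n p q, (N <= n)%N -> (p <= n)%N -> (q <= n)%N ->
  `|expectation B n p q -
    mean L (fun x => B.[expR (- xi (position R n p) (position R n q) x)])| <= e.
Proof.
have meanE L P Q : mean L (fun x => B.[expR (- xi P Q x)]) =
    \sum_(k < size B) B`_k * mean L (fun x => expR (- (k%:R * xi P Q x))).
  rewrite /mean; under [RHS]eq_bigr => k _ do rewrite mulrA mulr_sumr.
  rewrite -mulr_suml exchange_big /=; congr (_ / _).
  apply: eq_bigr => i _; rewrite horner_coef; apply: eq_bigr => k _.
  by rewrite -expRM_natl mulrN.
move=> e0.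
suff : exists L0, forall L, (L0 <= L)%N -> exists N, forall n p q,
    (N <= n)%N -> (p <= n)%N -> (q <= n)%N ->
    `|\sum_(k < size B) B`_k * rho_gen (decay R k n) p q -
      \sum_(k < size B) B`_k * mean L
        (fun x => expR (- (k%:R * xi (position R n p) (position R n q) x)))| <= e.
  by move=> [L0 h]; exists L0 => L /h[N hN]; exists N => n p q; rewrite meanE; exact: hN.
elim: (size B) e e0 => [|m IH] e e0.
  by exists 0%N => L _; exists 0%N => n p q _ _ _; rewrite !big_ord0 subrr normr0 ltW.
have e2 : 0 < e / 2 by lra.
have e3 : 0 < e / 2 / (`|B`_m| + 1) by rewrite divr_gt0 // ltr_wpDl.
have [L1 h1] := IH _ e2; have [L2 h2] := rho_gen_mean m e3.
exists (maxn L1 L2) => L; rewrite geq_max => /andP[/h1[N1 {}h1] /h2[N2 {}h2]].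
exists (maxn N1 N2) => n p q; rewrite geq_max => /andP[n1 n2] hp hq.
have {}h1 := h1 n p q n1 hp hq; have {}h2 := h2 n p q n2 hp hq.
rewrite !big_ord_recr /=.
set S1 := \sum_(_ < _) _ in h1 *; set S2 := \sum_(_ < _) _ in h1 *.
set x := rho_gen _ _ _ in h2 *; set y := mean _ _ in h2 *.
have -> : S1 + B`_m * x - (S2 + B`_m * y) = (S1 - S2) + B`_m * (x - y) by lra.
apply: le_trans (ler_normD _ _) _; rewrite [e]splitr lerD // normrM.
have B1 : 0 < `|B`_m| + 1 by rewrite ltr_wpDl.
apply: le_trans (_ : (`|B`_m| + 1) * (e / 2 / (`|B`_m| + 1)) <= _).
  by apply: ler_pM => //; rewrite lerDl.
by rewrite mulrC divfK // gt_eqF.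
Qed.

End StepFunction.

(** * The arcsine law *)

Section Limit.
Variable R : realType.

(** With [count_lower], the half-integers below [L] that exceed [y] number [L - y] up to [1 / 2]:
    this converts a proportion of nodes into an angle. *)
Lemma count_upper L (y : R) :
  \sum_(i < L) ((y < i%:R + 1 / 2)%R : nat)%:R <= Num.max 0 (L%:R - y + 1 / 2).
Proof.
elim: L => [|L IH]; first by rewrite big_ord0 le_max lexx.
rewrite big_ord_recr /= -[L.+1%:R]natr1; case: (ltP y) => h /=.
  apply: le_trans (lerD IH (lexx _)) _.
  by rewrite /Order.max; case: ltP => h1; case: ltP => h2; lra.
rewrite addr0; apply: le_trans IH _.
by rewrite /Order.max; case: ltP => h1; case: ltP => h2; lra.
Qed.

Lemma count_lower L (y : R) : 0 <= y ->
  L%:R - y - 1 / 2 <= \sum_(i < L) ((y < i%:R + 1 / 2)%R : nat)%:R.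
Proof.
move=> y0; elim: L => [|L IH]; first by rewrite big_ord0; lra.
have nn : 0 <= \sum_(i < L) ((y < i%:R + 1 / 2)%R : nat)%:R :> R.
  by apply: sumr_ge0 => i _; exact: ler0n.
rewrite big_ord_recr /= -[L.+1%:R]natr1; case: (ltP y) => h /=; lra.
Qed.

(** The arccosine of [w / s], clamped to 0 or [pi] when the threshold is out of reach; on the arc
    from 0 to [pi], [s * cos t <= w] means that [t] is beyond it. The arctangent form is that of the
    limit probability. *)
Definition angle (s w : R) : R :=
  if w ^+ 2 < s ^+ 2 then pi / 2 - atan (w / Num.sqrt (s ^+ 2 - w ^+ 2))
  else if w < 0 then pi else 0.

Lemma angle_itv s w : 0 <= angle s w <= pi.
Proof.
have p0 := @pi_gt0 R; rewrite /angle; case: ifP => _.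
  have := atan_gtNpi2 (w / Num.sqrt (s ^+ 2 - w ^+ 2)).
  have := atan_ltpi2 (w / Num.sqrt (s ^+ 2 - w ^+ 2)).
  lra.
by case: ifP => _; rewrite ?lexx ltW.
Qed.

Lemma cos_angle s w : 0 <= s -> w ^+ 2 < s ^+ 2 -> s * cos (angle s w) = w.
Proof.
move=> s0 ws; rewrite /angle ws.
set r := Num.sqrt _; have r0 : 0 < r by rewrite sqrtr_gt0 subr_gt0.
have r2 : r ^+ 2 = s ^+ 2 - w ^+ 2 by rewrite sqr_sqrtr // subr_ge0 ltW.
rewrite cosB cos_pihalf sin_pihalf mul0r add0r mul1r.
set a := atan _; have ca : cos a = r / s.
  rewrite /a cos_atan.
  have -> : 1 + (w / r) ^+ 2 = (s / r) ^+ 2.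
    rewrite !expr_div_n r2.
    have u : (s ^+ 2 - w ^+ 2) / (s ^+ 2 - w ^+ 2) = 1 by rewrite divff // gt_eqF // subr_gt0.
    by move: u; rewrite mulrBl; lra.
  by rewrite sqrtr_sqr ger0_norm ?divr_ge0 ?(ltW r0) // invf_div.
have s1 : 0 < s by rewrite lt0r s0 andbT; apply: contraTneq ws => ->; rewrite expr0n /= -leNgt sqr_ge0.
have ca0 : cos a != 0 by rewrite ca gt_eqF // divr_gt0.
have -> : sin a = w / r * cos a.
  have := atanK (w / r); rewrite -/a /tan => <-.
  by rewrite divfK.
rewrite ca.
have -> : s * (w / r * (r / s)) = w * (r / r) * (s / s) by lra.
by rewrite !divff ?gt_eqF // !mulr1.
Qed.

Lemma angle_cos_ge s w : 0 <= s -> 0 < angle s w -> w <= s * cos (angle s w).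
Proof.
move=> s0; case: (ltP (w ^+ 2) (s ^+ 2)) => h; first by rewrite cos_angle.
rewrite /angle (le_gtF h); case: ifP => w0; last by rewrite ltxx.
move=> _; rewrite cospi mulrN1 lerNr -(@ler_pXn2r _ 2) ?nnegrE ?oppr_ge0 ?(ltW w0) //.
by rewrite sqrrN.
Qed.

Lemma angle_cos_le s w : 0 <= s -> angle s w < pi -> s * cos (angle s w) <= w.
Proof.
move=> s0; case: (ltP (w ^+ 2) (s ^+ 2)) => h; first by rewrite cos_angle.
rewrite /angle (le_gtF h); case: (ltP w 0) => w0; first by rewrite ltxx.
by move=> _; rewrite cos0 mulr1 -(@ler_pXn2r _ 2) ?nnegrE.
Qed.

Lemma cos_sub x y : cos x - cos y = 2 * sin ((x + y) / 2) * sin ((y - x) / 2) :> R.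
Proof.
have -> : cos x = cos ((x + y) / 2 - (y - x) / 2) by congr cos; lra.
have -> : cos y = cos ((x + y) / 2 + (y - x) / 2) by congr cos; lra.
by rewrite cosB cosD; lra.
Qed.

Lemma sin_ge (t u : R) : 0 <= t -> t <= u -> u <= pi - t -> sin t <= sin u.
Proof.
move=> t0 tu ut.
have mono x : t <= x -> x <= pi / 2 -> sin t <= sin x.
  move=> tx xp; rewrite le_eqVlt; case: (ltgtP t x) tx => // [h _|-> _]; last by rewrite eqxx.
  by rewrite ltr_sin ?h ?orbT // in_itv /=; lra.
case: (leP u (pi / 2)) => h; first exact: mono.
have -> : sin u = sin (pi - u) by rewrite sinB sinpi cospi mul0r sub0r mulN1r opprK.
apply: mono; lra.
Qed.

(** The half sum and the half difference of [x] and [y] both lie between [eta / 2] and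
    [pi - eta / 2], so both sines in [cos_sub] are at least [sin (eta / 2)]. *)
Lemma cos_gap (x y eta : R) : 0 <= eta -> 0 <= x -> x + eta <= y -> y <= pi ->
  cos y + 2 * sin (eta / 2) ^+ 2 <= cos x.
Proof.
move=> e0 x0 xy yp; have := cos_sub x y.
have s0 : 0 <= sin (eta / 2) by apply: sin_ge0_pi; lra.
have h1 : sin (eta / 2) <= sin ((x + y) / 2) by apply: sin_ge; lra.
have h2 : sin (eta / 2) <= sin ((y - x) / 2) by apply: sin_ge; lra.
have := ler_pM s0 s0 h1 h2.
rewrite -expr2 => h3 h4.
move: h4; rewrite -mulrA; lra.
Qed.

(* [(s, w)] stays away from the point where the arcsine law degenerates to a
   point mass at the threshold. *)
Definition nondegenerate (s0 s w : R) : Prop := s0 <= s \/ 2 * s0 <= `|w|.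

(** The margin [d] must not depend on [(s, w)]. If [s >= s0], it is [s0] times the gap of the
    cosine. If [s < s0], then [s * cos t] stays at distance [s0] from [w], always on the same
    side. *)
Lemma angle_separation (s0 eta : R) : 0 < s0 -> 0 < eta -> eta < pi ->
  exists2 d : R, 0 < d <= 1 & forall s w, 0 <= s -> nondegenerate s0 s w ->
  forall t, 0 <= t -> t <= pi ->
    (s * cos t < w + d -> angle s w - eta < t) /\
    (angle s w + eta < t -> s * cos t <= w - d).
Proof.
move=> s00 eta0 etap.
have sn : 0 < sin (eta / 2) by apply: sin_gt0_pi; apply/andP; split; lra.
have g0 : 0 < 2 * s0 * sin (eta / 2) ^+ 2 by rewrite mulr_gt0 ?exprn_gt0 // mulr_gt0.
exists (Num.min 1 (Num.min s0 (2 * s0 * sin (eta / 2) ^+ 2))).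
  by rewrite !lt_min ltr01 s00 g0 ge_min lexx.
move=> s w sge nd t t0 tp; set d := Num.min _ _.
have d1 : d <= s0 by rewrite !ge_min lexx orbT.
have d2 : d <= 2 * s0 * sin (eta / 2) ^+ 2 by rewrite !ge_min lexx !orbT.
have /andP[a0 ap] := angle_itv s w.
case: (leP s0 s) => hs.
  have gap : d <= s * (2 * sin (eta / 2) ^+ 2).
    apply: le_trans d2 _; rewrite (_ : 2 * s0 * _ = s0 * (2 * sin (eta / 2) ^+ 2)); last lra.
    by rewrite ler_wpM2r // mulr_ge0 // sqr_ge0.
  split=> h.
    rewrite ltNge; apply/negP => ht.
    have h1 := @cos_gap t (angle s w) eta (ltW eta0) t0 ltac:(lra) ap.
    have h2 := angle_cos_ge sge (w := w) ltac:(lra).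
    have := ler_wpM2l sge h1; rewrite mulrDr; lra.
  have h1 := @cos_gap (angle s w) t eta (ltW eta0) a0 ltac:(lra) tp.
  have h2 := angle_cos_le sge (w := w) ltac:(lra).
  have := ler_wpM2l sge h1; rewrite mulrDr; lra.
have {}nd : 2 * s0 <= `|w| by case: nd => //; rewrite leNgt hs.
have sw : ~~ (w ^+ 2 < s ^+ 2).
  rewrite -leNgt -[leRHS]real_normK ?num_real // lerXn2r ?nnegrE //; lra.
have st : `|s * cos t| <= s0.
  rewrite normrM (ger0_norm sge); apply: le_trans (ltW hs).
  by rewrite ler_piMr // cos_max.
move: st; rewrite ler_norml => /andP[st1 st2].
rewrite /angle (negPf sw); case: (ltP w 0) => w0.
  rewrite ltr0_norm // in nd; split=> h; exfalso; lra.
rewrite ger0_norm // in nd; split=> h; lra.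
Qed.

Lemma theta_itv L i : (i < L)%N -> 0 <= theta R L i <= pi.
Proof.
move=> iL; have p0 := @pi_gt0 R; have L0 : 0 < L%:R :> R by rewrite ltr0n; lia.
have iL1 : i%:R + 1 <= L%:R :> R by rewrite natr1 ler_nat.
have i0 : 0 <= i%:R + 1 / 2 :> R by rewrite addr_ge0.
rewrite /theta; apply/andP; split; first by rewrite divr_ge0 // mulr_ge0 // ltW.
rewrite ler_pdivrMr //; apply: ler_wpM2l; first exact: ltW.
lra.
Qed.

Lemma lt_theta L i y : (0 < L)%N -> (y < theta R L i) = (L%:R * y / pi < i%:R + 1 / 2).
Proof.
move=> L0; have p0 := @pi_gt0 R; have LR : 0 < L%:R :> R by rewrite ltr0n.
by rewrite /theta ltr_pdivlMr // ltr_pdivrMr // mulrC [_ * pi]mulrC.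
Qed.

Lemma mean_le_count L f (b : nat -> bool) e : (0 < L)%N ->
  (forall i, (i < L)%N -> f (theta R L i) <= (b i)%:R + e) ->
  mean L f <= (\sum_(i < L) (b i)%:R) / L%:R + e.
Proof.
move=> L0 h; have LR : 0 < L%:R :> R by rewrite ltr0n.
rewrite /mean ler_pdivrMr // mulrDl divfK ?gt_eqF //.
apply: le_trans (_ : \sum_(i < L) ((b i)%:R + e) <= _); first by apply: ler_sum => i _; exact: h.
by rewrite big_split /= sumr_const card_ord mulr_natr.
Qed.

Lemma mean_ge_count L f (b : nat -> bool) e : (0 < L)%N ->
  (forall i, (i < L)%N -> (b i)%:R - e <= f (theta R L i)) ->
  (\sum_(i < L) (b i)%:R) / L%:R - e <= mean L f.
Proof.
move=> L0 h; have LR : 0 < L%:R :> R by rewrite ltr0n.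
rewrite /mean ler_pdivlMr // mulrBl divfK ?gt_eqF //.
apply: le_trans (_ : \sum_(i < L) ((b i)%:R - e) <= _); last by apply: ler_sum => i _; exact: h.
by rewrite sumrB sumr_const card_ord mulr_natr.
Qed.

(** Since [2 P Q <= (P + Q)^2]. It puts [exp (- xi)] between 0 and 1, where the step polynomials are
    controlled. *)
Lemma xi_ge0 (P Q x : R) : 0 <= P -> 0 <= Q -> 0 <= xi P Q x.
Proof.
move=> P0 Q0; rewrite /xi.
set r := Num.sqrt _; have r0 : 0 <= r by rewrite sqrtr_ge0.
have r2 : r ^+ 2 = 2 * (P * Q) by rewrite sqr_sqrtr // !mulr_ge0.
have rPQ : r <= P + Q.
  rewrite -(@ler_pXn2r _ 2) ?nnegrE ?addr_ge0 // r2.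
  have := sqr_ge0 P; have := sqr_ge0 Q; rewrite sqrrD; lra.
have : r * - 1 <= r * cos x by rewrite ler_wpM2l // cos_geN1.
lra.
Qed.

Lemma decay_var_ge n M : (0 < n)%N -> (M <= n)%N -> expR (-1) <= decay_var R n M.
Proof.
move=> n0 Mn; rewrite /decay_var ler_expR lerN2 ler_pdivrMr ?ltr0n //.
by rewrite mul1r ler_nat.
Qed.

Lemma decay_var_le n M : (0 < n)%N -> (n <= M)%N -> decay_var R n M <= expR (-1).
Proof.
move=> n0 Mn; rewrite /decay_var ler_expR lerN2 ler_pdivlMr ?ltr0n //.
by rewrite mul1r ler_nat.
Qed.

(** Here [xi P Q x = 1 - w + s * cos x], so the event [M < n] corresponds to [s * cos x] lying below
    [w], that is, to angles beyond [angle s w]. *)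
Lemma cdf_limit (s0 eta : R) : 0 < s0 -> 0 < eta -> exists N, forall n p q,
  (N <= n)%N -> (p <= n)%N -> (q <= n)%N ->
  let P := position R n p in let Q := position R n q in
  let s := 2 * Num.sqrt (2 * (P * Q)) in let w := 1 - 2 * (P + Q) in
  nondegenerate s0 s w ->
  `|cdf R p q n - (1 - angle s w / pi)| < eta.
Proof.
move=> s00 eta0; have p0 := @pi_gt0 R.
(* On either side five errors of size [e] add up: the step polynomial on [M], the mean, the step
   polynomial on the nodes, the angle margin [g], and the node count. *)
pose e := eta / 8; have e0 : 0 < e by rewrite /e; lra.
pose g := Num.min (pi * e) (pi / 2).
have g0 : 0 < g by rewrite lt_min mulr_gt0 //= divr_gt0.
have gp : g < pi by apply: le_lt_trans (_ : pi / 2 < pi); [rewrite ge_min lexx orbT | lra].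
have ge1 : g / pi <= e by rewrite ler_pdivrMr // mulrC ge_min lexx.
clearbody g.
have [d /andP[d0 d1] sep] := angle_separation s00 g0 gp.
have lt12 : expR (- (1 + d)) < expR (-1) :> R by rewrite ltr_expR; lra.
have lt23 : expR (-1) < expR (- (1 - d)) :> R by rewrite ltr_expR; lra.
have le21 : expR (-1) <= 1 :> R by rewrite expR_le1; lra.
have le31 : expR (- (1 - d)) <= 1 :> R by rewrite expR_le1; lra.
(* [B] jumps just below [exp (- 1)] and bounds the indicator of [M < n] from above; [B'] jumps just
   above and bounds it from below. Both transitions correspond to values of [xi] within [d] of 1. *)
have [B hB] := step_poly (expR_ge0 _) lt12 le21 e0.
have [B' hB'] := step_poly (expR_ge0 _) lt23 le31 e0.
have [L1 h1] := expectation_mean B e0; have [L2 h2] := expectation_mean B' e0.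
pose L := maxn (maxn L1 L2) (Num.truncn e^-1).+1.
have L0 : (0 < L)%N by rewrite leq_max orbT.
have LR : 0 < L%:R :> R by rewrite ltr0n.
have Le : 1 / 2 / L%:R <= e.
  rewrite ler_pdivrMr //; apply: le_trans (_ : e * e^-1 <= _).
    by rewrite divff ?gt_eqF //; lra.
  rewrite ler_wpM2l ?(ltW e0) //; have e0' : 0 <= e^-1 by rewrite invr_ge0 ltW.
  have /andP[_ h] := truncn_itv e0'; apply: le_trans (ltW h) _.
  by rewrite ler_nat leq_maxr.
have [N1 {}h1] : exists N, forall n p q, (N <= n)%N -> (p <= n)%N -> (q <= n)%N ->
    `|expectation B n p q -
      mean L (fun x => B.[expR (- xi (position R n p) (position R n q) x)])| <= e.
  by apply: h1; rewrite /L -maxnA leq_maxl.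
have [N2 {}h2] : exists N, forall n p q, (N <= n)%N -> (p <= n)%N -> (q <= n)%N ->
    `|expectation B' n p q -
      mean L (fun x => B'.[expR (- xi (position R n p) (position R n q) x)])| <= e.
  by apply: h2; rewrite /L !leq_max leqnn !orbT.
exists (maxn (maxn N1 N2) 1) => n p q; rewrite !geq_max => /andP[/andP[n1 n2] n0] hp hq.
have {}h1 := h1 n p q n1 hp hq; have {}h2 := h2 n p q n2 hp hq.
move=> P Q s w nd; rewrite -/P -/Q in h1 h2.
have P0 : 0 <= P by exact: position_ge0.
have Q0 : 0 <= Q by exact: position_ge0.
have sge : 0 <= s by rewrite mulr_ge0 ?sqrtr_ge0.
have {}sep := sep s w sge nd.
have /andP[a0 ap] := angle_itv s w.
have Va M : 0 <= decay_var R n M by exact: expR_ge0.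
have Vb M : decay_var R n M <= 1 by rewrite expR_le1 oppr_le0 divr_ge0.
have xiE x : xi P Q x = 1 - w + s * cos x by rewrite /xi /w /s; lra.
have Ea x : 0 <= expR (- xi P Q x) by exact: expR_ge0.
have Eb x : expR (- xi P Q x) <= 1 by rewrite expR_le1 oppr_le0 xi_ge0.
have f1 : cdf R p q n <= expectation B n p q + e.
  apply: cdf_le (ltW e0) _ _ => M; first by have [] := hB _ (Va M) (Vb M).
  by move=> Mn; have [_ _ _] := hB _ (Va M) (Vb M); apply; rewrite decay_var_ge // ltnW.
have f2 : expectation B' n p q - e <= cdf R p q n.
  apply: cdf_ge (ltW e0) _ _ => M; first by have [] := hB' _ (Va M) (Vb M).
  by move=> Mn; have [_ _ + _] := hB' _ (Va M) (Vb M); apply; rewrite decay_var_le.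
have m1 : mean L (fun x => B.[expR (- xi P Q x)]) <=
    (\sum_(i < L) ((L%:R * (angle s w - g) / pi < i%:R + 1 / 2)%R : nat)%:R) / L%:R + e.
  apply: (mean_le_count (b := fun i => L%:R * (angle s w - g) / pi < i%:R + 1 / 2)) => // i iL.
  rewrite -lt_theta //; have /andP[t0 tp] := theta_itv iL.
  have [_ b1 b2 _] := hB _ (Ea (theta R L i)) (Eb (theta R L i)).
  case: (ltP (angle s w - g)) => ht /=; first by apply: le_trans b1 _; lra.
  rewrite add0r; apply: b2; rewrite ler_expR lerN2 xiE.
  have [sep1 _] := sep _ t0 tp.
  suff : w + d <= s * cos (theta R L i) by lra.
  by rewrite leNgt; apply/negP => /sep1; rewrite ltNge ht.
have m2 : (\sum_(i < L) ((L%:R * (angle s w + g) / pi < i%:R + 1 / 2)%R : nat)%:R) / L%:R - e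
    <= mean L (fun x => B'.[expR (- xi P Q x)]).
  apply: (mean_ge_count (b := fun i => L%:R * (angle s w + g) / pi < i%:R + 1 / 2)) => // i iL.
  rewrite -lt_theta //; have /andP[t0 tp] := theta_itv iL.
  have [b0 _ _ b2] := hB' _ (Ea (theta R L i)) (Eb (theta R L i)).
  case: (ltP (angle s w + g)) => ht /=; last by apply: le_trans b0; lra.
  apply: b2; rewrite ler_expR lerN2 xiE.
  have [_ sep2] := sep _ t0 tp.
  by have := sep2 ht; lra.
have c1 : (\sum_(i < L) ((L%:R * (angle s w - g) / pi < i%:R + 1 / 2)%R : nat)%:R) / L%:R <=
    1 - angle s w / pi + e + e.
  have ang1 : angle s w / pi <= 1 by rewrite ler_pdivrMr // mul1r.
  rewrite ler_pdivrMr //; apply: le_trans (count_upper _ _) _; rewrite ge_max; apply/andP; split.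
    by rewrite mulr_ge0 // ?(ltW LR) //; lra.
  have e1 : 1 / 2 <= e * L%:R by rewrite -ler_pdivrMr.
  have e2 : L%:R * (g / pi) <= L%:R * e by rewrite ler_pM2l.
  have -> : L%:R * (angle s w - g) / pi = L%:R * (angle s w / pi) - L%:R * (g / pi) by lra.
  lra.
have c2 : 1 - angle s w / pi - e - e <=
    (\sum_(i < L) ((L%:R * (angle s w + g) / pi < i%:R + 1 / 2)%R : nat)%:R) / L%:R.
  rewrite ler_pdivlMr //; apply: le_trans (count_lower L _); last first.
    by rewrite divr_ge0 ?(ltW p0) // mulr_ge0 ?(ltW LR) // addr_ge0 // ltW.
  have e1 : 1 / 2 <= e * L%:R by rewrite -ler_pdivrMr.
  have e2 : L%:R * (g / pi) <= L%:R * e by rewrite ler_pM2l.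
  have -> : L%:R * (angle s w + g) / pi = L%:R * (angle s w / pi) + L%:R * (g / pi) by lra.
  lra.
move: h1 h2; rewrite !ler_norml => /andP[h1 h1'] /andP[h2 h2'].
rewrite ltr_norml; apply/andP; split; move: f1 f2 m1 m2 c1 c2 h1 h1' h2 h2' e0; rewrite /e;
  move: (mean _ _) (mean _ _) (expectation _ _ _ _) (expectation _ _ _ _) (cdf _ _ _ _)
    (angle s w / pi) (_ / L%:R) (_ / L%:R) => *; lra.
Qed.

End Limit.

(** * Return to normalized locations *)

(** The coloring makes the midpoint of the bottom edge a cell center, so north-going spaces are
    exactly the top edges that [top_rho] treats. *)
Lemma north_going_cell (R : realType) n (i j : int) : north_going R n.+1 (i, j) ->
  exists p q : nat, [/\ (p <= n)%N, (q <= n)%N, i + 1 = q%:Z - p%:Z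
    & j = n%:Z - p%:Z - q%:Z].
Proof.
move=> /north_goingE[/aztecE /= h1 /aztecE /= h2 /= h3]; move: h3; rewrite /parity_white /= => h3.
have hr : `|i + 1| + `|j| <= n%:Z by lia.
have hp : (2 %| i + 1 + j + n%:Z)%Z by lia.
have [p [q]] := center_surj hr hp.
rewrite /center => -[e1 e2]; exists p, q.
by split; [exact: ltn_ord p | exact: ltn_ord q | exact: esym e1 | exact: esym e2].
Qed.

Lemma placement_prob_cdf (R : realType) n (p q : nat) (i j : int) :
  i + 1 = q%:Z - p%:Z -> j = n%:Z - p%:Z - q%:Z ->
  placement_prob R n.+1 (hspace (i, j)) = cdf R p q n.+1.
Proof.
move=> hi hj; have -> : i = q%:Z - p%:Z - 1 by lia.
by rewrite hj -/(top_prob R n.+1 _ _) top_rho.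
Qed.

(** The identity [s^2 - w^2 = 1 - 2 x^2 - 2 y^2] turns the condition [w^2 < s^2] into the interior
    of the arctic circle. *)
Lemma limit_prob_angle (R : realType) (x y s w : R) :
  s ^+ 2 = 2 * ((1 - y) ^+ 2 - x ^+ 2) -> w = 2 * y - 1 ->
  limit_prob (x, y) = 1 - angle s w / pi.
Proof.
move=> hs hw; have pi0 : (pi : R) != 0 by rewrite gt_eqF // pi_gt0.
rewrite /limit_prob /angle hs hw.
have -> : ((2 * y - 1) ^+ 2 < 2 * ((1 - y) ^+ 2 - x ^+ 2)) = (x ^+ 2 + y ^+ 2 < 1 / 2).
  by apply/idP/idP; rewrite !sqrrB; lra.
case: ifP => _.
  have -> : 2 * ((1 - y) ^+ 2 - x ^+ 2) - (2 * y - 1) ^+ 2 = 1 - 2 * x ^+ 2 - 2 * y ^+ 2.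
    by rewrite !sqrrB; lra.
  move: (atan _) => t; have pipi : pi * (pi : R)^-1 = 1 by rewrite divff.
  have -> : (pi / 2 - t) / pi = 1 / 2 * (pi * pi^-1) - t / pi by lra.
  by rewrite pipi; lra.
have -> : (2 * y - 1 < 0) = (y < 1 / 2) by apply/idP/idP; lra.
by case: ifP => _; rewrite ?divff ?mul0r ?subrr ?subr0.
Qed.

Lemma corner_ball (R : realType) (U : set (R * R)) (a b : R) : open U -> U (a, b) ->
  exists2 r : R, 0 < r & forall x y, `|x - a| < r -> `|y - b| < r -> U (x, y).
Proof.
move=> Uo Uab; have /nbhs_ballP[r r0 hr] : nbhs (a, b) U by apply: open_nbhs_nbhs.
exists r => // x y hx hy; apply: hr; split => /=; rewrite /ball /= distrC //.
Qed.

Theorem theorem1 (R : realType) (U : set (R * R)) (Uopen : open U)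
    (Ur : U (1 / 2, 1 / 2)) (Ul : U (- (1 / 2), 1 / 2)) :
  forall eta : R, 0 < eta ->
  exists N : nat, forall n : nat, (N <= n)%N ->
  forall s : square, north_going R n s ->
    ~ U (normalized_location R n s) ->
    `|placement_prob R n (hspace s) - limit_prob (normalized_location R n s)|
      < eta.
Proof.
move=> eta eta0.
have [r1 r10 h1] := corner_ball Uopen Ur; have [r2 r20 h2] := corner_ball Uopen Ul.
pose r := Num.min (1 / 2) (Num.min r1 r2).
have r0 : 0 < r by rewrite !lt_min r10 r20 !andbT.
have rle : r <= 1 / 2 by rewrite ge_min lexx.
have rle1 : r <= r1 by rewrite !ge_min lexx orbT.
have rle2 : r <= r2 by rewrite !ge_min lexx !orbT.
clearbody r.
have r20' : 0 < r / 2 by lra.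
have [N hN] := cdf_limit r20' eta0.
exists (maxn N 1) => -[|n]; first by rewrite geq_max ltn0 andbF.
rewrite geq_max => /andP[Nn _] [i j] ng nU.
have [p [q [hp hq hi hj]]] := north_going_cell ng.
rewrite (placement_prob_cdf R hi hj).
pose x : R := (i + 1)%:~R / n.+1%:R; pose y : R := j%:~R / n.+1%:R.
have xyE : normalized_location R n.+1 (i, j) = (x, y) by [].
rewrite xyE in nU *.
have natz_R (k : nat) : (k%:Z)%:~R = k%:R :> R by [].
have n0 : n.+1%:R != 0 :> R by rewrite pnatr_eq0.
have ni : n.+1%:R * n.+1%:R^-1 = 1 :> R by rewrite divff.
have xE : x = position R n.+1 q - position R n.+1 p.
  by rewrite /x hi intrB /position !natz_R; move: (n.+1%:R^-1) => z; lra.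
have yE : y = 1 - (position R n.+1 p + position R n.+1 q).
  rewrite /y hj !intrB !natz_R /position.
  have := @natr1 R n; move: ni; move: (n.+1%:R) (n.+1%:R^-1) => m z mz nm.
  move: mz; rewrite -nm; lra.
pose P := position R n.+1 p; pose Q := position R n.+1 q.
rewrite -/P -/Q in xE yE.
pose s := 2 * Num.sqrt (2 * (P * Q)); pose w := 1 - 2 * (P + Q).
have main : nondegenerate (r / 2) s w -> `|cdf R p q n.+1 - (1 - angle s w / pi)| < eta
  := hN n.+1 p q Nn (leqW hp) (leqW hq).
have P0 : 0 <= P by exact: position_ge0.
have Q0 : 0 <= Q by exact: position_ge0.
have s2 : s ^+ 2 = 8 * (P * Q).
  by rewrite /s exprMn sqr_sqrtr ?mulr_ge0 //; lra.
have sge : 0 <= s by rewrite mulr_ge0 ?sqrtr_ge0.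
rewrite (@limit_prob_angle R x y s w); last 2 first.
- rewrite s2 xE yE !sqrrB; lra.
- by rewrite /w yE; lra.
apply: main.
(* Far from the height [1 / 2] the threshold [w = 2 * y - 1] is large. Near it, avoiding both corner
   balls keeps [x] strictly between them, hence [P] and [Q] are at least [r / 4] and
   [s ^+ 2 = 8 * (P * Q)] is bounded below. *)
case: (leP (r / 2) `|y - 1 / 2|) => hy; [right|left].
  have -> : w = 2 * (y - 1 / 2) by rewrite /w yE; lra.
  by rewrite normrM ger0_norm // ler_pM2l.
move: hy; rewrite ltr_norml => /andP[hy1 hy2].
have yr : `|y - 1 / 2| < r by rewrite ltr_norml; lra.
have far1 : r <= `|x - 1 / 2|.
  rewrite leNgt; apply/negP => hx; apply: nU; apply: h1.
    exact: lt_le_trans hx rle1.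
  exact: lt_le_trans yr rle1.
have far2 : r <= `|x - - (1 / 2)|.
  rewrite leNgt; apply/negP => hx; apply: nU; apply: h2.
    exact: lt_le_trans hx rle2.
  exact: lt_le_trans yr rle2.
rewrite -(@ler_pXn2r _ 2) ?nnegrE // ?(ltW r20') // s2.
clear h1 h2 nU xyE.
have PQ : r / 4 <= P /\ r / 4 <= Q.
  move: far1 far2; rewrite !ler_normr => /orP[a|a] /orP[b|b]; split; lra.
have : r / 4 * (r / 4) <= P * Q by apply: ler_pM; lra.
have := mulr_ge0 (ltW r0) (ltW r0); rewrite expr2; lra.
Qed.
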